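(* Let $E$ be a polygon inscribed in $\mathbb{T}$. Let $P_n(z)=\sum_{k=0}^n A_{k,n}z^k$, $n\in\mathbb{N}$, be a sequence of random polynomials, where the $A_{k,n}$ are complex valued random variables (not necessarily independent nor identically distributed) such that, for a fixed $t>0$, $$\sup\{\mathbb{E}[|A_{k,n}|^t] : k=0,\ldots,n,\ n\in\mathbb{N}\}<\infty$$ and $$\inf\{\mathbb{E}[\log|A_{k,n}|] : k\in\{0,n\},\ n\in\mathbb{N}\}>-\infty.$$ Then the expected number of zeros of $P_n$ in $E$ satisfies $$\mathbb{E}[n\tau_n(E)]=O\left(\sqrt{n\log n}\right)\quad\text{as } n\to\infty.$$
   Context: $\mathbb{T}=\{z\in\mathbb{C}:|z|=1\}$ is the unit circumference; a polygon is inscribed in $\mathbb{T}$ if all of its vertices lie on $\mathbb{T}$. For a polynomial $P_n$ of degree $n$ with complex zeros $Z_1,\ldots,Z_n$ (listed with multiplicity), the zero counting measure is $\tau_n=\frac1n\sum_{k=1}^n\delta_{Z_k}$, so $n\tau_n(E)$ is the number of zeros of $P_n$ in $E$. (The hypotheses imply $A_{0,n}A_{n,n}\ne0$ almost surely.) *)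

(* Defs.v *)
From HB Require Import structures.
From mathcomp Require Import all_boot all_order all_algebra.
From mathcomp Require Import all_classical all_reals all_analysis.
From mathcomp Require Import complex.
Set Implicit Arguments.
Unset Strict Implicit.
Unset Printing Implicit Defensive.
Import Order.TTheory GRing.Theory Num.Theory.
Import numFieldNormedType.Exports.

Local Open Scope classical_set_scope.
Local Open Scope ring_scope.
Local Open Scope complex_scope.

(* The norm `|z| of z : R[i] lives in R[i]; this is the same modulus, as an
   element of R. *)
Notation cmod := (ComplexField.Normc.normc) (only parsing).

Section Polygon.
Context {R : realType}.

(* `[0, 1] is taken in R[i], whose (partial) order only compares numbers with
   equal imaginary parts, so it is the real unit interval. *)
Definition segment (a b : R[i]) : set R[i] := line_path a b @` `[0, 1].

Section Chain.
Variables (m : nat) (v : 'I_m -> R[i]).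

(* ordS is the cyclic successor, so the chain is closed *)
Definition edge (i : 'I_m) : set R[i] := segment (v i) (v (ordS i)).

Definition chain : set R[i] := \bigcup_i edge i.

(* Distinct edges meet only in a common endpoint: consecutive edges share one
   vertex and non-consecutive ones are disjoint. *)
Definition simple_chain : Prop :=
  [/\ (3 <= m)%N, injective v &
      forall i j, i != j -> edge i `&` edge j `<=`
        [set v i; v (ordS i)] `&` [set v j; v (ordS j)]].

(* The closed region bounded by the chain: the chain and the bounded
   components of its complement. R[i]^o carries the norm topology of R[i]. *)
Definition region : set R[i] :=
  chain `|` [set z | (~` chain) z /\
    bounded_set (connected_component (~` chain : set R[i]^o) z)].

End Chain.

Definition unit_circle : set R[i] := [set z | cmod z = 1].

Definition inscribed_polygon (E : set R[i]) : Prop :=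
  exists m (v : 'I_m -> R[i]),
    [/\ simple_chain v, forall i, unit_circle (v i) & E = region v].

End Polygon.

Section Zeros.
Context {R : realType}.

(* Zeros listed with multiplicity; the zero polynomial gets the empty list. *)
Definition zeros (p : {poly R[i]}) : seq R[i] :=
  if p == 0 then [::] else sval (closed_field_poly_normal p).

(* The value at E of n^-1 times the sum of the Dirac masses at the zeros. *)
Definition zero_counting (n : nat) (p : {poly R[i]}) (E : set R[i]) : R :=
  n%:R^-1 * \sum_(z <- zeros p) \1_E z.

End Zeros.

Section RandomPolynomial.
Context {d : measure_display} {T : measurableType d} {R : realType}.

Definition complex_random_variable (X : T -> R[i]) : Prop :=
  measurable_fun setT (fun w => complex.Re (X w)) /\
  measurable_fun setT (fun w => complex.Im (X w)).

Definition random_poly (A : nat -> nat -> T -> R[i]) (n : nat) (w : T) :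
    {poly R[i]} :=
  \poly_(k < n.+1) A k n w.

End RandomPolynomial.

(* Main.v *)
Require Import Defs.
From HB Require Import structures.
From mathcomp Require Import all_boot all_order all_algebra.
From mathcomp Require Import all_classical all_reals all_analysis.
From mathcomp Require Import complex.
From mathcomp Require Import cyclic separable cyclotomic measurable_realfun.
From mathcomp Require Import ring lra zify.
Set Implicit Arguments.
Unset Strict Implicit.
Unset Printing Implicit Defensive.
Import Order.TTheory GRing.Theory Num.Theory.
Import numFieldNormedType.Exports.

Local Open Scope classical_set_scope.
Local Open Scope ring_scope.
Local Open Scope complex_scope.

Import ComplexField.Normc.

(** An inscribed polygon meets the unit circle only at its vertices, and near
    each vertex it lies in an angle smaller than a straight one.  Hence for
    small [delta] a zero of [P_n] in the polygon either satisfies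
    [|z| <= 1 - delta], or lies within [C * delta] of one of the finitely many
    vertices ([region_near_vertex]; it rests on the fact that the region lies in
    every closed half-plane which contains the vertices, [region_half_plane]).
    Both kinds of zeros are counted by a deterministic inequality in which only
    the height of [P_n] matters, that is, how much the sum [M] of the moduli of
    the coefficients exceeds [|A_0|] and [|A_n|].

    The starting point is that [ln |P_n|] has an upper bound on the circle.
    Invert the zeros outside a circle of radius [rho] just above 1 into it and
    rescale: up to a constant factor, [|P_n|] becomes on that circle
    [\prod_j |1 - w y_j|] with all [y_j] in the open unit disc ([fold_disc]).
    The upper bound becomes [\sum_j ln |1 - w y_j| <= H] for [|w| = 1], where
    [H] is the height.  The mean of the left side over the circle is 0, so
    integrating against the nonnegative weight [1 + Re (c w^m)] bounds its
    [m]-th Fourier coefficient: [|\sum_j y_j^m| <= 2 m H] ([power_sum_le]).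
    The integrals are replaced by averages over the [N]-th roots of unity, with
    [N] tending to infinity.

    For the zeros near a vertex [v], sum the Poisson kernel of radius
    [r = 1 - delta] over the [y_j].  It is positive, it is at least of order
    [1 / delta] at distance [O(delta)] from [v], and by the power sum bounds its
    sum is at most [3 n + 4 H / delta^2] ([sum_poisson_le]).  So there are
    [O(n delta + H / delta)] zeros there ([count_near_unit_point_le]).
    For the zeros of modulus at most [1 - delta], [H >= 0] is a form of Jensen's
    inequality and gives [O((ln M + 1 - ln |A_0|) / delta)] of them
    ([count_small_disc_le]).

    It remains to take expectations.  The moment hypothesis makes the mean of
    [ln M] at most of order [ln n], and the logarithmic hypothesis bounds the
    means of [- ln |A_0|] and [- ln |A_n|]; so the expected count is
    [O(n delta + ln n / delta)], and [delta = sqrt (ln n / n)] balances the two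
    terms. *)

(** * Complex moduli and the logarithm series *)

Section Modulus.
Context {R : realType}.
Implicit Types z w : R[i].

Lemma cmod_ge0 z : 0 <= cmod z.
Proof. by case: z => a b /=; exact: sqrtr_ge0. Qed.

Lemma cmod0 : cmod (0 : R[i]) = 0. Proof. exact: normc0. Qed.

Lemma cmod1 : cmod (1 : R[i]) = 1. Proof. exact: normc1. Qed.

Lemma cmod_norm z : (cmod z)%:C = `|z|.
Proof. by []. Qed.

Lemma cmod_gt0 z : (0 < cmod z) = (z != 0).
Proof. by rewrite -ltcR cmod_norm normr_gt0. Qed.

Lemma cmodX z k : cmod (z ^+ k) = cmod z ^+ k.
Proof. by elim: k => [|k IH]; rewrite ?expr0 ?cmod1 // !exprS normcM IH. Qed.

Lemma cmod_sqr z : cmod z ^+ 2 = complex.Re z ^+ 2 + complex.Im z ^+ 2.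
Proof. by case: z => a b /=; rewrite sqr_sqrtr // addr_ge0 ?sqr_ge0. Qed.

Lemma cmodJ z : cmod (conjc z) = cmod z.
Proof. by case: z => a b /=; rewrite sqrrN. Qed.

Lemma cmodC (x : R) : cmod x%:C = `|x|.
Proof. by rewrite /= expr0n addr0 sqrtr_sqr. Qed.

Lemma cmodB z w : cmod (z - w) = cmod (w - z).
Proof. by rewrite -normcN opprB. Qed.

Lemma Re_le_cmod z : complex.Re z <= cmod z.
Proof.
case: z => a b /=; apply: le_trans (ler_norm a) _.
by rewrite -sqrtr_sqr ler_wsqrtr // lerDl sqr_ge0.
Qed.

Lemma normRe_le_cmod z : `|complex.Re z| <= cmod z.
Proof.
by case: z => a b /=; rewrite -sqrtr_sqr ler_wsqrtr // lerDl sqr_ge0.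
Qed.

Lemma cmod_sum (I : Type) (s : seq I) (f : I -> R[i]) :
  cmod (\sum_(i <- s) f i) <= \sum_(i <- s) cmod (f i).
Proof.
elim: s => [|i s IH]; first by rewrite !big_nil cmod0.
by rewrite !big_cons (le_trans (le_normcD _ _)) // lerD2l.
Qed.

Lemma Re_sum (I : Type) (s : seq I) (P : pred I) (f : I -> R[i]) :
  complex.Re (\sum_(i <- s | P i) f i) = \sum_(i <- s | P i) complex.Re (f i).
Proof. by elim/big_rec2: _ => // i x y _ <-; case: (f i) => ? ?; case: y. Qed.

Lemma ReD z w : complex.Re (z + w) = complex.Re z + complex.Re w.
Proof. by case: z; case: w. Qed.

Lemma ReN z : complex.Re (- z) = - complex.Re z.
Proof. by case: z. Qed.

Lemma ReZ (x : R) z : complex.Re (x%:C * z) = x * complex.Re z.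
Proof. by case: z => a b /=; rewrite mul0r subr0. Qed.

Lemma conjcM z w : conjc (z * w) = conjc z * conjc w.
Proof. exact: (rmorphM (@conjc R)). Qed.

Lemma conjcB z w : conjc (z - w) = conjc z - conjc w.
Proof. exact: (rmorphB (@conjc R)). Qed.

Lemma conjcN z : conjc (- z) = - conjc z.
Proof. exact: (rmorphN (@conjc R)). Qed.

Lemma mulcJ z : z * conjc z = (cmod z ^+ 2)%:C.
Proof.
rewrite cmod_sqr; case: z => a b; apply/eqP; rewrite eq_complex /=.
by apply/andP; split; apply/eqP; ring.
Qed.

Lemma cmod1_neq0 w : cmod w = 1 -> w != 0.
Proof. by move=> w1; rewrite -cmod_gt0 w1. Qed.

Lemma invc_cmod1 w : cmod w = 1 -> w^-1 = conjc w.
Proof.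
move=> w1; apply: (mulfI (cmod1_neq0 w1)).
by rewrite mulfV ?cmod1_neq0 // mulcJ w1 expr1n.
Qed.

End Modulus.

Lemma one_sub_neq0 {R : realType} (w : R[i]) : cmod w < 1 -> 1 - w != 0.
Proof.
by move=> w1; apply/eqP => /subr0_eq e; move: w1; rewrite -e cmod1 ltxx.
Qed.

Lemma cmod_one_sub_ge {R : realType} (w : R[i]) : 1 - cmod w <= cmod (1 - w).
Proof.
rewrite lerBlDr; apply: le_trans (le_normcD _ _).
by rewrite subrK cmod1.
Qed.

Section LogSeries.
Context {R : realType}.
Implicit Types w : R[i].

Lemma ReX_real (t : R) w l :
  complex.Re ((t%:C * w) ^+ l) = t ^+ l * complex.Re (w ^+ l).
Proof. by rewrite exprMn -rmorphXn /= ReZ. Qed.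

Lemma truncated_geometric w N : w != 1 -> (0 < N)%N ->
  \sum_(1 <= l < N) w ^+ l = (w - w ^+ N) / (1 - w).
Proof.
move=> w1; have d : 1 - w != 0 by rewrite subr_eq0 eq_sym.
case: N => // N _; elim: N => [|N IH].
  by rewrite big_geq // expr1 subrr mul0r.
rewrite big_nat_recr //= IH; apply: (mulIf d); rewrite mulrDl !mulfVK //.
by rewrite !exprS; ring.
Qed.

Lemma Re_div_one_sub w : w != 1 ->
  complex.Re (w / (1 - w)) =
  (complex.Re w - cmod w ^+ 2) / cmod (1 - w) ^+ 2.
Proof.
move=> w1; have: cmod (1 - w) ^+ 2 != 0.
  by rewrite expf_neq0 // gt_eqF // cmod_gt0 subr_eq0 eq_sym.
rewrite !cmod_sqr; case: w {w1} => a b /=.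
rewrite sub0r => h; field.
by move: h; rewrite !expr2.
Qed.

(** The power series of [ln (1 - w)] with an explicit remainder.  Along
    the ray [t |-> t w] the derivative of the left side is
    [- Re ((t w)^N / (1 - t w)) / t], so the mean value theorem applies and no
    complex logarithm is needed. *)
Lemma ln_cmod_series w N : cmod w < 1 -> (0 < N)%N ->
  `| ln (cmod (1 - w)) + \sum_(1 <= l < N) complex.Re (w ^+ l) / l%:R |
  <= cmod w ^+ N / (1 - cmod w).
Proof.
move=> w1 N0; set n := cmod w; set x := complex.Re w.
have tw1 (t : R) : 0 <= t -> t <= 1 -> cmod (t%:C * w) < 1.
  move=> t0 t1; rewrite normcM cmodC ger0_norm //; apply: le_lt_trans w1.
  by rewrite ler_piMl ?cmod_ge0.
(* D and S are the squared modulus of 1 - t w and the truncated series as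
   polynomials in t, for which derivatives are available *)
pose D : {poly R} := 1 - (2 * x) *: 'X + n ^+ 2 *: 'X^2.
pose S : {poly R} := \sum_(1 <= l < N) (complex.Re (w ^+ l) / l%:R) *: 'X^l.
have DE t : D.[t] = cmod (1 - t%:C * w) ^+ 2.
  by rewrite /D !hornerE /x /n !cmod_sqr; case: (w) => a b /=; ring.
have D0 (t : R) : 0 <= t -> t <= 1 -> 0 < D.[t].
  by move=> t0 t1; rewrite DE exprn_gt0 // cmod_gt0 one_sub_neq0 ?tw1.
pose phi t := 2^-1 * ln D.[t] + S.[t].
pose dphi t := 2^-1 * (D^`().[t] / D.[t]) + S^`().[t].
have dD (t : R) : 0 <= t -> t <= 1 -> is_derive t (1 : R) phi (dphi t).
  move=> t0 t1; have h := is_derive1_ln (D0 t t0 t1).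
  have hc : is_derive t (1 : R) (@ln R \o horner D) (D.[t]^-1 * D^`().[t]).
    exact: is_derive1_comp.
  apply: is_deriveD; rewrite [_ / _]mulrC.
  exact: is_deriveZ.
have cphi (t : R) : 0 <= t -> t <= 1 -> {for t, continuous phi}.
  move=> t0 t1; apply: differentiable_continuous.
  by apply/derivable1_diffP; have [] := dD t t0 t1.
have [||c] := @MVT R phi dphi 0 1 ltr01.
- by move=> t; rewrite in_itv => /andP[? ?]; apply: dD; apply: ltW.
- apply: continuous_in_subspaceT => t; rewrite inE /= in_itv /= => /andP[].
  exact: cphi.
rewrite in_itv /= => /andP[c0 c1]; rewrite subr0 mulr1.
have -> : phi 0 = 0.
  rewrite /phi DE mul0r subr0 cmod1 expr1n ln1 mulr0 add0r horner_sum.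
  rewrite big_nat big1 // => l /andP[l0 _]; rewrite !hornerE expr0n.
  by rewrite gtn_eqF // mulr0.
have -> : phi 1 =
    ln (cmod (1 - w)) + \sum_(1 <= l < N) complex.Re (w ^+ l) / l%:R.
  rewrite /phi DE mul1r lnXn ?cmod_gt0 ?one_sub_neq0 // -[ln _ *+ 2]mulr_natl.
  rewrite mulrA mulVf ?pnatr_eq0 // mul1r; congr (_ + _).
  by rewrite horner_sum; apply: eq_bigr => l _; rewrite !hornerE expr1n mulr1.
rewrite subr0 => ->.
have u1 := tw1 c (ltW c0) (ltW c1); set u := c%:C * w in u1 *.
have un : u != 1.
  by apply/eqP => e; move: u1; rewrite e cmod1 ltxx.
have -> : dphi c = - complex.Re (u ^+ N / (1 - u)) / c.
  apply: (mulIf (lt0r_neq0 c0)); rewrite divfK ?lt0r_neq0 //.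
  rewrite /dphi mulrDl.
  have -> : S^`().[c] * c = complex.Re ((u - u ^+ N) / (1 - u)).
    rewrite -truncated_geometric // Re_sum /S (linear_sum (@deriv R)).
    rewrite horner_sum mulr_suml.
    rewrite !big_nat; apply: eq_bigr => -[//|l] _.
    rewrite ReX_real /= derivZ derivXn hornerZ hornerMn hornerXn /= exprSr.
    rewrite -(mulr_natl (c ^+ l)) exprS; field.
    by rewrite ?natr1 ?nat1r pnatr_eq0.
  have -> : 2^-1 * (D^`().[c] / D.[c]) * c = - complex.Re (u / (1 - u)).
    have -> : D^`().[c] = 2 * (n ^+ 2 * c - x).
      by rewrite /D !poly.derivE !hornerE; ring.
    rewrite Re_div_one_sub // DE -/u /u normcM cmodC ger0_norm ?ltW // ReZ.
    rewrite -/u -/x -/n; have : cmod (1 - u) != 0.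
      by rewrite gt_eqF // cmod_gt0 one_sub_neq0.
    by move: (cmod (1 - u)) => k k0; field.
  by rewrite mulrBl ReD ReN; ring.
rewrite mulNr normrN normrM normfV (gtr0_norm c0) ler_pdivrMr //.
apply: le_trans (normRe_le_cmod _) _.
rewrite normcM normcV cmodX mulrAC.
have n1 : 0 < 1 - n by rewrite subr_gt0.
have u_n : cmod u <= n.
  by rewrite /u normcM cmodC gtr0_norm // ler_piMl ?cmod_ge0 // ltW.
apply: ler_pM.
- by rewrite exprn_ge0 ?cmod_ge0.
- by rewrite invr_ge0 cmod_ge0.
- rewrite /u normcM cmodC gtr0_norm // exprMn mulrC.
  rewrite ler_wpM2l ?exprn_ge0 ?cmod_ge0 //.
  by rewrite -[leRHS]expr1 ler_wiXn2l // ltW.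
rewrite lef_pV2 ?posrE //; last by rewrite cmod_gt0 one_sub_neq0.
by apply: le_trans (cmod_one_sub_ge u); rewrite lerD2l lerN2.
Qed.
End LogSeries.

(** * Power sums of points of the open disc *)

Section PowerSums.
Context {R : realType}.
Implicit Types (w y c z : R[i]) (s : seq R[i]).

Lemma prim_root_complex N : (0 < N)%N -> exists z : R[i], N.-primitive_root z.
Proof.
move=> N0; pose p : {poly R[i]} := 'X^N - 1.
have [r Dp] := closed_field_poly_normal p.
rewrite (monicP _) ?monicXnsubC // scale1r in Dp.
have rn1 : all N.-unity_root r.
  by apply/allP => z; rewrite -root_prod_XsubC -Dp.
have sz_r : (N < (size r).+1)%N.
  by rewrite -(size_prod_XsubC r id) -Dp size_XnsubC.
have [|z] := hasP (has_prim_root N0 rn1 _ sz_r); last by exists z.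
by rewrite -separable_prod_XsubC -Dp separable_Xn_sub_1 // pnatr_eq0 -lt0n.
Qed.

Lemma cmod_prim_root N z :
  (0 < N)%N -> N.-primitive_root z -> cmod z = 1.
Proof.
move=> N0 /prim_expr_order zN.
have : cmod z ^+ N = 1 by rewrite -cmodX zN cmod1.
by move/eqP; rewrite pexpr_eq1 ?cmod_ge0 // => /eqP.
Qed.

Lemma sum_prim_root N z l : N.-primitive_root z ->
  \sum_(k < N) (z ^+ k) ^+ l = if (N %| l)%N then N%:R else 0.
Proof.
move=> pz; have zlN : (z ^+ l) ^+ N = 1.
  by rewrite -exprM mulnC exprM (prim_expr_order pz) expr1n.
rewrite (eq_bigr (fun k : 'I_N => (z ^+ l) ^+ k)); last first.
  by move=> k _; rewrite -!exprM mulnC.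
have := subrX1 (z ^+ l) N; rewrite zlN subrr => /esym/eqP.
rewrite mulf_eq0 subr_eq0 (prim_order_dvd pz).
case: eqP => [->|_] /= h; last exact/eqP.
by rewrite (eq_bigr (fun=> 1)) ?sumr_const ?card_ord // => k _; rewrite expr1n.
Qed.

(** Nonnegative weights on the unit circle, of mean 1 over the [N]-th roots of
    unity for [0 < m < N], whose product with a function picks out its [m]-th
    Fourier coefficient. *)
Definition tilt c m z : R := 1 + complex.Re (c * z ^+ m).

Lemma tilt_ge0 c m z : cmod c = 1 -> cmod z = 1 -> 0 <= tilt c m z.
Proof.
move=> c1 z1; have := normRe_le_cmod (c * z ^+ m).
by rewrite normcM cmodX c1 z1 expr1n mulr1 ler_norml /tilt => /andP[]; lra.
Qed.

(** Summing over the [N]-th roots of unity keeps a frequency only if it is 0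
    modulo [N]; the weight shifts [l] by 0, [m] and [- m], the last one written
    as [N - m]. *)
Lemma sum_tilt N z c m l : N.-primitive_root z -> (0 < m < N)%N ->
  \sum_(k < N) (tilt c m (z ^+ k))%:C * (z ^+ k) ^+ l =
  (if (N %| l)%N then N%:R else 0) +
  2^-1 * (c * (if (N %| l + m)%N then N%:R else 0) +
          conjc c * (if (N %| l + (N - m))%N then N%:R else 0)).
Proof.
move=> pz /andP[m0 mN]; have N0 : (0 < N)%N by apply: leq_trans mN.
rewrite -!(sum_prim_root _ pz) !mulr_sumr -big_split /= mulr_sumr -big_split /=.
apply: eq_bigr => k _; set u := z ^+ k.
have uN : u ^+ N = 1.
  by rewrite /u -exprM mulnC exprM (prim_expr_order pz) expr1n.
have u1 : cmod u = 1.
  by rewrite /u cmodX (cmod_prim_root N0 pz) expr1n.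
have -> : (tilt c m u)%:C = 1 + 2^-1 * (c * u ^+ m + conjc c * u ^+ (N - m)).
  have -> : u ^+ (N - m) = conjc (u ^+ m).
    have um1 : cmod (u ^+ m) = 1 by rewrite cmodX u1 expr1n.
    rewrite -(invc_cmod1 um1); apply: (mulfI (cmod1_neq0 um1)).
    by rewrite mulfV ?cmod1_neq0 // -exprD subnKC ?uN // ltnW.
  rewrite -rmorphM /= addcJ mulrA mulVf ?mul1r ?pnatr_eq0 // /tilt.
  by rewrite rmorphD.
by rewrite !exprD; ring.
Qed.

Lemma sum_tilt_one N z c m : N.-primitive_root z -> (0 < m < N)%N ->
  \sum_(k < N) tilt c m (z ^+ k) = N%:R.
Proof.
move=> pz mN; apply: (@complexI R).
have := sum_tilt c 0 pz mN; rewrite dvdn0 !add0n => h.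
rewrite rmorph_sum /= rmorph_nat; move: h.
have [m0 mN'] := andP mN.
rewrite !gtnNdvd ?subn_gt0 // ?ltn_subrL ?m0 ?(leq_trans _ mN') //.
rewrite /= !mulr0 addr0 mulr0 addr0 => <-.
by apply: eq_bigr => k _; rewrite expr0 mulr1.
Qed.

(** The constant part of the weight contributes nothing because the
    series has no term of degree 0 modulo [N]; degree [m] is the Fourier
    coefficient that is wanted, and degree [N - m] is its alias. *)
Lemma sum_tilt_series N z c m y : N.-primitive_root z -> (0 < m < N)%N ->
  \sum_(k < N) tilt c m (z ^+ k) *
     \sum_(1 <= l < N) complex.Re ((z ^+ k * y) ^+ l) / l%:R =
  N%:R / 2 * (complex.Re (c * y ^+ (N - m)) / (N - m)%:R +
          complex.Re (conjc c * y ^+ m) / m%:R).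
Proof.
move=> pz mN; have [m0 mN'] := andP mN.
under eq_bigr => k _ do rewrite mulr_sumr.
rewrite exchange_big /=.
have key l :
    \sum_(k < N) tilt c m (z ^+ k) *
      (complex.Re ((z ^+ k * y) ^+ l) / l%:R) =
    complex.Re ((\sum_(k < N) (tilt c m (z ^+ k))%:C * (z ^+ k) ^+ l) * y ^+ l)
      / l%:R.
  rewrite mulr_suml Re_sum mulr_suml; apply: eq_bigr => k _.
  by rewrite exprMn -mulrA ReZ mulrA.
under eq_bigr => l _ do rewrite key sum_tilt //.
have d1 l : (1 <= l < N)%N -> (N %| l)%N = false.
  by move=> /andP[l0 lN]; rewrite gtnNdvd.
have d2 l : (1 <= l < N)%N -> (N %| l + m)%N = (l == N - m)%N.
  move=> lN; apply/idP/eqP => [/dvdnP[k e]|->]; last by rewrite subnK // ltnW.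
  by case: k e => [|[|k]] e; nia.
have d3 l : (1 <= l < N)%N -> (N %| l + (N - m))%N = (l == m).
  move=> lN; apply/idP/eqP => [/dvdnP[k e]|->]; last by rewrite subnKC // ltnW.
  by case: k e => [|[|k]] e; nia.
have pick j (F : nat -> R) : (1 <= j < N)%N ->
    \sum_(1 <= l < N) (if l == j then F l else 0) = F j.
  move=> jN; rewrite (bigD1_seq j) ?iota_uniq ?mem_index_iota //= eqxx.
  by rewrite big1 ?addr0 // => l /negbTE ->.
pose F b l := N%:R / 2 * (complex.Re (b * y ^+ l) / l%:R).
transitivity (F c (N - m)%N + F (conjc c) m); last by rewrite mulrDr.
rewrite -(pick (N - m)%N (F c)); last by lia.
rewrite -(pick m (F (conjc c))) // /F.
rewrite -big_split /= !big_nat; apply: eq_bigr => l lN.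
rewrite d1 // d2 // d3 // add0r.
have e2 : (2^-1 : R[i]) = (2^-1)%:C by rewrite fmorphV rmorph_nat.
rewrite e2 -(mulrA (2^-1)%:C) ReZ mulrDl ReD.
have aux (b : bool) (a : R[i]) :
    complex.Re (a * (if b then N%:R else 0) * y ^+ l) =
    if b then N%:R * complex.Re (a * y ^+ l) else 0.
  case: b; last by rewrite mulr0 mul0r.
  by rewrite mulrAC mulrC -(rmorph_nat (real_complex R)) ReZ.
rewrite !aux; case: (l == _); case: (l == _); ring.
Qed.

(** For fixed [m] the error term [q ^+ (N - m)] tends to 0 with [N]; it
    covers both the alias [N - m] and the remainder of the logarithm series. *)
Lemma sum_tilt_ln_ge N z c m y q : N.-primitive_root z -> (0 < m < N)%N ->
  cmod c = 1 -> cmod y <= q -> q < 1 ->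
  - (N%:R * (complex.Re (conjc c * y ^+ m) / (2 * m%:R) +
             q ^+ (N - m) * (1 + (1 - q)^-1)))
  <= \sum_(k < N) tilt c m (z ^+ k) * ln (cmod (1 - z ^+ k * y)).
Proof.
move=> pz mN c1 yq q1; have [m0 mN'] := andP mN.
have N0 : (0 < N)%N by apply: leq_trans mN'.
have q0 : 0 <= q := le_trans (cmod_ge0 _) yq.
have q1' : 0 < 1 - q by rewrite subr_gt0.
have z1 k : cmod (z ^+ k) = 1 by rewrite cmodX (cmod_prim_root N0 pz) expr1n.
set E := q ^+ N / (1 - q).
have low k : - E - \sum_(1 <= l < N) complex.Re ((z ^+ k * y) ^+ l) / l%:R
    <= ln (cmod (1 - z ^+ k * y)).
  have u1 : cmod (z ^+ k * y) < 1 by rewrite normcM z1 mul1r (le_lt_trans yq).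
  have := ln_cmod_series u1 N0; rewrite ler_norml => /andP[h _].
  rewrite lerBlDr; apply: le_trans h; rewrite lerN2 /E.
  rewrite normcM z1 mul1r; apply: ler_pM => //.
  - by rewrite exprn_ge0 ?cmod_ge0.
  - by rewrite invr_ge0 subr_ge0 ltW // (le_lt_trans yq).
  - by rewrite lerXn2r // nnegrE ?cmod_ge0.
  - by rewrite lef_pV2 ?posrE ?subr_gt0 ?(le_lt_trans yq) // lerD2l lerN2.
have : \sum_(k < N) tilt c m (z ^+ k) *
      (- E - \sum_(1 <= l < N) complex.Re ((z ^+ k * y) ^+ l) / l%:R) <=
    \sum_(k < N) tilt c m (z ^+ k) * ln (cmod (1 - z ^+ k * y)).
  by apply: ler_sum => k _; rewrite ler_wpM2l ?tilt_ge0.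
apply: le_trans.
under eq_bigr => k _ do rewrite mulrBr.
rewrite sumrB sum_tilt_series // -mulr_suml sum_tilt_one //.
set A := complex.Re (conjc c * _); set B := complex.Re _.
set p := q ^+ (N - m).
have BB : B / (N - m)%:R <= p.
  rewrite ler_pdivrMr ?ltr0n ?subn_gt0 //; apply: le_trans (Re_le_cmod _) _.
  rewrite normcM cmodX c1 mul1r; apply: le_trans (_ : p <= _).
    by rewrite lerXn2r ?nnegrE ?cmod_ge0.
  by rewrite ler_peMr ?exprn_ge0 // ler1n subn_gt0.
have EE : E <= p / (1 - q).
  rewrite ler_pM2r ?invr_gt0 //.
  by apply: ler_wiXn2l => //; [exact: ltW|exact: leq_subr].
have Nge : 0 <= N%:R :> R by [].
have p0 : 0 <= p by rewrite exprn_ge0.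
have -> : A / (2 * m%:R) = 2^-1 * (A / m%:R) by rewrite invfM; ring.
move: (A / _) (B / _) BB => A' B' BB.
rewrite -subr_ge0; set X := (X in 0 <= X).
have -> : X = N%:R * ((p / (1 - q) - E) + (p - B') / 2 + p / 2).
  by rewrite /X; field; rewrite gt_eqF.
apply: mulr_ge0 => //; apply: addr_ge0; last exact: divr_ge0.
by apply: addr_ge0; [rewrite subr_ge0|rewrite divr_ge0 ?subr_ge0].
Qed.

Lemma exists_opposite_phase z :
  exists2 c, cmod c = 1 & conjc c * z = - (cmod z)%:C.
Proof.
have [->|z0] := eqVneq z 0.
  by exists 1; rewrite ?cmod1 // mulr0 cmod0 rmorph0 oppr0.
have k0 : cmod z != 0 by rewrite gt_eqF // cmod_gt0.
exists (- ((cmod z)^-1)%:C * z).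
  by rewrite normcM normcN cmodC ger0_norm ?invr_ge0 ?cmod_ge0 // mulVf.
rewrite conjcM conjcN conjc_real.
rewrite -mulrA (mulrC (conjc z)) mulcJ mulNr -rmorphM /=.
by rewrite expr2 mulrA mulVf // mul1r.
Qed.

(** A function on the circle which has mean 0 and is at most [H] has
    all its Fourier coefficients bounded by multiples of [H]: test it against
    [1 + Re (c w^m)], with [c] chosen so that the [m]-th coefficient counts with
    its full modulus.  Here the [m]-th coefficient of [\sum_y ln |1 - w y|] is
    [- (\sum_y y^m) / (2 m)], up to conjugation. *)
Lemma power_sum_le s (H : R) m : (0 < m)%N -> {in s, forall y, cmod y < 1} ->
  (forall w, cmod w = 1 -> \sum_(y <- s) ln (cmod (1 - w * y)) <= H) ->
  cmod (\sum_(y <- s) y ^+ m) <= 2 * m%:R * H.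
Proof.
move=> m0 s1 hH.
(* a common bound q < 1, as the points are finitely many *)
have [q q0 [q1 sq]] : exists2 q, 0 < q & q < 1 /\ {in s, forall y, cmod y <= q}.
  elim: s s1 {hH} => [|y s IH] s1; first by exists 2^-1; [lra|split; [lra|]].
  have [|q q0 [q1 hq]] := IH.
    by move=> x xs; apply: s1; rewrite inE xs orbT.
  exists (Num.max q (cmod y)); first by rewrite lt_max q0.
  split; first by rewrite gt_max q1 s1 ?mem_head.
  by move=> x; rewrite inE le_max => /orP[/eqP->|/hq->]; rewrite ?lexx ?orbT.
set S := \sum_(y <- s) y ^+ m.
have [c c1 cS] := exists_opposite_phase S.
set K := 1 + (1 - q)^-1.
have bound j : cmod S / (2 * m%:R) - (size s)%:R * (q ^+ j.+1 * K) <= H.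
  pose N := (m + j.+1)%N.
  have mN : (0 < m < N)%N by rewrite m0 /N -addSnnS leq_addr.
  have N0 : (0 < N)%N by apply: leq_trans (andP mN).2.
  have [z pz] := prim_root_complex N0.
  have Npos : 0 < N%:R :> R by rewrite ltr0n.
  rewrite -(ler_pM2l Npos).
  have : \sum_(k < N) tilt c m (z ^+ k) *
      \sum_(y <- s) ln (cmod (1 - z ^+ k * y)) <= N%:R * H.
    rewrite -(sum_tilt_one c pz mN) mulr_suml; apply: ler_sum => k _.
    have zk1 : cmod (z ^+ k) = 1 by rewrite cmodX (cmod_prim_root N0 pz) expr1n.
    by rewrite ler_wpM2l ?tilt_ge0 ?hH.
  apply: le_trans.
  under [leRHS]eq_bigr => k _ do rewrite mulr_sumr.
  rewrite exchange_big /=.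
  have -> : N%:R * (cmod S / (2 * m%:R) - (size s)%:R * (q ^+ j.+1 * K)) =
      \sum_(y <- s) - (N%:R * (complex.Re (conjc c * y ^+ m) / (2 * m%:R) +
                                q ^+ j.+1 * K)).
    rewrite sumrN -mulr_sumr -[RHS]mulrN; congr (_ * _).
    rewrite big_split /= -mulr_suml -Re_sum -mulr_sumr cS ReN /=.
    by rewrite big_const_seq count_predT iter_addr_0 -mulr_natl; ring.
  rewrite big_seq [leRHS]big_seq; apply: ler_sum => y ys.
  have := sum_tilt_ln_ge pz mN c1 (sq _ ys) q1.
  by rewrite /N addKn.
have : cmod S / (2 * m%:R) <= H.
  have cv :
    (fun j => cmod S / (2 * m%:R) - (size s)%:R * (q ^+ j.+1 * K)) @ \oo -->
      cmod S / (2 * m%:R) - (size s)%:R * (0 * K).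
    apply: cvgB; first exact: cvg_cst.
    apply: cvgMr; apply: cvgMl.
    have := @cvg_expr R q; rewrite ger0_norm ?ltW // => /(_ q1) h.
    by move: h; rewrite -cvg_shiftS.
  rewrite mul0r mulr0 subr0 in cv.
  apply: (cvgr_to_le cv).
  by near=> j; exact: bound.
by rewrite ler_pdivrMr ?mulr_gt0 ?ltr0n // mulrC.
Unshelve. all: by end_near. Qed.
End PowerSums.

(** * Summing the Poisson kernel *)

Section Poisson.
Context {R : realType}.
Implicit Types (v w y z : R[i]) (s : seq R[i]).

(** A partial sum of [r / (1 - r)^2], bounded through the closed form of
    its remainder. *)
Lemma sum_arithmetic_geometric_le (r : R) K : 0 <= r -> r < 1 ->
  \sum_(1 <= m < K) m%:R * r ^+ m <= (1 - r) ^- 2.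
Proof.
move=> r0 r1; have d : 0 < 1 - r by rewrite subr_gt0.
have -> : \sum_(1 <= m < K) m%:R * r ^+ m = \sum_(0 <= m < K) m%:R * r ^+ m.
  case: K => [|K]; first by rewrite !big_geq.
  by rewrite [RHS]big_nat_recl // mul0r add0r big_add1.
have e : (1 - r) ^+ 2 * \sum_(0 <= m < K) m%:R * r ^+ m
   + r ^+ K * (K%:R * (1 - r) + r) = r.
  elim: K => [|K IH]; first by rewrite big_geq // mulr0 expr0; ring.
  by rewrite big_nat_recr //= -natr1 (exprS r) -[RHS]IH; ring.
rewrite -(ler_pM2l (exprn_gt0 2 d)) mulfV ?gt_eqF ?exprn_gt0 //.
have : 0 <= r ^+ K * (K%:R * (1 - r) + r).
  by rewrite mulr_ge0 ?exprn_ge0 // addr_ge0 // mulr_ge0 // ltW.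
lra.
Qed.

(** The Poisson kernel is [Re ((1 + y) / (1 - y)) = 1 + 2 Re (y / (1 - y))].
    Cutting the geometric series at [K] costs [2 Re (y^K / (1 - y)) <= 2], which
    turns the constant 1 into 3. *)
Lemma poisson_le_series y (r : R) K :
  (0 < K)%N -> cmod y <= r -> r < 1 -> r ^+ K <= 1 - r ->
  (1 - cmod y ^+ 2) / cmod (1 - y) ^+ 2 <=
  3 + 2 * complex.Re (\sum_(1 <= m < K) y ^+ m).
Proof.
move=> K0 yr r1 rK; have y1 : cmod y < 1 := le_lt_trans yr r1.
have yn1 : y != 1 by apply/eqP => e; move: y1; rewrite e cmod1 ltxx.
have d : 0 < cmod (1 - y) by rewrite cmod_gt0 one_sub_neq0.
have -> : (1 - cmod y ^+ 2) / cmod (1 - y) ^+ 2 =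
    1 + 2 * complex.Re (y / (1 - y)).
  rewrite Re_div_one_sub //.
  have e : cmod (1 - y) ^+ 2 = 1 - 2 * complex.Re y + cmod y ^+ 2.
    by rewrite !cmod_sqr; case: (y) => a b /=; ring.
  rewrite e; field.
  by rewrite -e gt_eqF // exprn_gt0.
rewrite truncated_geometric // mulrBl ReD ReN.
suff : complex.Re (y ^+ K / (1 - y)) <= 1 by lra.
apply: le_trans (Re_le_cmod _) _.
rewrite normcM normcV cmodX ler_pdivrMr // mul1r.
apply: le_trans (_ : r ^+ K <= _).
  by rewrite lerXn2r ?nnegrE ?cmod_ge0 // (le_trans (cmod_ge0 y)).
apply: le_trans rK _; apply: le_trans (cmod_one_sub_ge y).
by rewrite lerD2l lerN2.
Qed.

(** Since the kernel weights [y^m] by [r^m], power sums of size [O(m H)]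
    add up to [O(H / (1 - r)^2)]. *)
Lemma sum_poisson_le s (H r : R) v : cmod v = 1 -> 0 <= r -> r < 1 ->
  {in s, forall y, cmod y < 1} ->
  (forall m, (0 < m)%N -> cmod (\sum_(y <- s) y ^+ m) <= 2 * m%:R * H) ->
  \sum_(y <- s) (1 - (r * cmod y) ^+ 2) / cmod (1 - r%:C * v * y) ^+ 2
  <= 3 * (size s)%:R + 4 * H / (1 - r) ^+ 2.
Proof.
move=> v1 r0 r1 s1 sH; have d : 0 < 1 - r by rewrite subr_gt0.
have H0 : 0 <= H.
  have := le_trans (cmod_ge0 _) (sH 1%N isT).
  by rewrite mulr1 pmulr_rge0.
have [K K0 rK] : exists2 K, (0 < K)%N & r ^+ K <= 1 - r.
  have := @cvg_expr R r; rewrite ger0_norm // => /(_ r1) h.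
  have [N _ hN] := cvgr_le _ h _ d.
  by exists N.+1 => //; apply: hN => /=.
have cu y : cmod (r%:C * v * y) = r * cmod y.
  by rewrite !normcM v1 mulr1 cmodC ger0_norm.
apply: le_trans (_ : \sum_(y <- s)
  (3 + 2 * complex.Re (\sum_(1 <= m < K) (r%:C * v * y) ^+ m)) <= _).
  rewrite big_seq [leRHS]big_seq; apply: ler_sum => y ys.
  rewrite -cu; apply: poisson_le_series rK => //.
  by rewrite cu ler_piMr // ltW // s1.
rewrite big_split /= big_const_seq count_predT iter_addr_0.
rewrite -(mulr_natr 3) lerD2l.
rewrite -mulr_sumr -Re_sum exchange_big /=.
apply: le_trans (_ : 2 * \sum_(1 <= m < K) r ^+ m * (2 * m%:R * H) <= _).
  rewrite ler_pM2l // Re_sum [leLHS]big_nat [leRHS]big_nat.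
  apply: ler_sum => m /andP[m0 _].
  apply: le_trans (Re_le_cmod _) _.
  under eq_bigr => y _ do rewrite exprMn.
  rewrite -mulr_sumr normcM cmodX normcM cmodC v1 mulr1 ger0_norm //.
  by rewrite ler_wpM2l ?exprn_ge0 // sH.
have -> : 2 * \sum_(1 <= m < K) r ^+ m * (2 * m%:R * H) =
    4 * H * \sum_(1 <= m < K) m%:R * r ^+ m.
  by rewrite !mulr_sumr; apply: eq_bigr => m _; ring.
by rewrite ler_wpM2l ?mulr_ge0 // sum_arithmetic_geometric_le.
Qed.
End Poisson.

(** * Counting zeros near the circle and near the origin *)

Section Folding.
Context {R : realType}.
Implicit Types (v w y z Z : R[i]) (zs : seq R[i]).

(** Rescale the disc of radius [rho] to the unit disc, after inverting the
    points outside it in its boundary circle. *)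
Definition fold_disc (rho : R) z : R[i] :=
  if cmod z <= rho then z / rho%:C else rho%:C / conjc z.

Lemma cmod_fold_disc_lt1 (rho : R) z : 0 < rho -> cmod z != rho ->
  cmod (fold_disc rho z) < 1.
Proof.
move=> rho0 zr; rewrite /fold_disc; case: ifPn => h.
  by rewrite normcM normcV cmodC gtr0_norm // ltr_pdivrMr // mul1r lt_neqAle zr.
rewrite -ltNge in h; rewrite normcM normcV cmodC cmodJ gtr0_norm //.
by rewrite ltr_pdivrMr ?mul1r // (lt_trans rho0).
Qed.

(** Inversion multiplies the distance to every point of the circle by a
    constant, so folding a zero changes the modulus of its linear factor on the
    circle by the factor [max rho |z|] only. *)
Lemma cmod_sub_fold_disc (rho : R) w z : 0 < rho -> cmod w = 1 ->
  cmod (rho%:C * conjc w - z) =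
  Num.max rho (cmod z) * cmod (1 - w * fold_disc rho z).
Proof.
move=> rho0 w1; have wn := cmod1_neq0 w1.
have rn : rho%:C != 0 :> R[i] by rewrite -cmod_gt0 cmodC gtr0_norm.
have ww : w * conjc w = 1 by rewrite mulcJ w1 expr1n.
rewrite /fold_disc; case: ifPn => h.
  rewrite max_l //.
  have -> : rho%:C * conjc w - z =
      rho%:C * (conjc w * (1 - w * (z / rho%:C))).
    rewrite mulrBr mulr1 (mulrA (conjc w)) (mulrC (conjc w) w) ww mul1r mulrBr.
    congr (_ - _).
    by rewrite mulrCA mulfV ?mulr1.
  by rewrite !normcM cmodJ w1 mul1r cmodC gtr0_norm.
rewrite -ltNge in h; rewrite max_r ?ltW //.
have zn : conjc z != 0 by rewrite -cmod_gt0 cmodJ (lt_trans rho0).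
rewrite -(cmodJ z) -normcM -(cmodJ (_ - z)) conjcB conjcM conjcK conjc_real.
rewrite -normcN; congr (cmod _); rewrite mulrBr mulr1 opprB; congr (_ - _).
by rewrite mulrCA (mulrCA (conjc z)) mulfV // mulr1 mulrC.
Qed.

Lemma cmod_horner_roots (a : R[i]) zs z :
  cmod (a *: \prod_(Z <- zs) ('X - Z%:P)).[z] =
  cmod a * \prod_(Z <- zs) cmod (z - Z).
Proof.
rewrite hornerZ normcM; congr (_ * _); rewrite horner_prod.
elim: zs => [|Z zs IH]; first by rewrite !big_nil cmod1.
by rewrite !big_cons normcM IH !hornerE.
Qed.

Lemma ln_prod_seq (I : eqType) (s : seq I) (F : I -> R) :
  {in s, forall i, 0 < F i} ->
  0 < \prod_(i <- s) F i /\ ln (\prod_(i <- s) F i) = \sum_(i <- s) ln (F i).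
Proof.
elim: s => [|i s IH] h; first by rewrite !big_nil ln1.
have [p e] : 0 < \prod_(j <- s) F j /\
    ln (\prod_(j <- s) F j) = \sum_(j <- s) ln (F j).
  by apply: IH => j js; apply: h; rewrite inE js orbT.
have hi : 0 < F i by apply: h; rewrite mem_head.
by rewrite !big_cons mulr_gt0 // lnM ?posrE // e.
Qed.

Lemma ln_cmod_horner_roots (a : R[i]) zs z : a != 0 -> z \notin zs ->
  ln (cmod (a *: \prod_(Z <- zs) ('X - Z%:P)).[z]) =
  ln (cmod a) + \sum_(Z <- zs) ln (cmod (z - Z)).
Proof.
move=> a0 zzs; rewrite cmod_horner_roots.
have [p e] : 0 < \prod_(Z <- zs) cmod (z - Z) /\
    ln (\prod_(Z <- zs) cmod (z - Z)) = \sum_(Z <- zs) ln (cmod (z - Z)).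
  apply: ln_prod_seq => Z Zs; rewrite cmod_gt0 subr_eq0.
  by apply: contraNneq zzs => ->.
by rewrite lnM ?posrE ?cmod_gt0 // e.
Qed.

End Folding.

Section Counting.
Context {R : realType}.
Variables (a : R[i]) (zs : seq R[i]) (rho L : R).
Let p : {poly R[i]} := a *: \prod_(Z <- zs) ('X - Z%:P).
Hypothesis a0 : a != 0.
Hypothesis rho1 : 1 <= rho.
Hypothesis zs_rho : {in zs, forall Z, cmod Z != rho}.
Hypothesis pL : forall z, cmod z = rho -> ln (cmod p.[z]) <= L.

(** The bound [L] for [ln |p|] on the circle of radius [rho], minus the mean of
    [ln |p|] over that circle. *)
Let excess := L - ln (cmod a) - \sum_(Z <- zs) ln (Num.max rho (cmod Z)).

Let rho0 : 0 < rho. Proof. exact: lt_le_trans ltr01 rho1. Qed.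

(** On the circle of radius [rho], [ln |p|] and the sum over the folded
    zeros differ by a constant, which turns the bound [L] into [excess]. *)
Lemma folded_power_sum_le m : (0 < m)%N ->
  cmod (\sum_(y <- [seq fold_disc rho Z | Z <- zs]) y ^+ m) <=
  2 * m%:R * excess.
Proof.
move=> m0; apply: power_sum_le => // [y /mapP[Z Zs ->]|w w1].
  by apply: cmod_fold_disc_lt1 => //; exact: zs_rho.
have z1 : cmod (rho%:C * conjc w) = rho.
  by rewrite normcM cmodC cmodJ w1 mulr1 gtr0_norm.
have zn : rho%:C * conjc w \notin zs.
  by apply/negP => /zs_rho; rewrite z1 eqxx.
have := pL z1; rewrite ln_cmod_horner_roots //.
move=> h; rewrite /excess big_map !lerBrDr addrC.
apply: le_trans h; rewrite lerD2l -big_split /=.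
rewrite big_seq [leRHS]big_seq; apply: ler_sum => Z Zs.
have m0' : 0 < Num.max rho (cmod Z) by rewrite lt_max rho0.
have c0 : 0 < cmod (1 - w * fold_disc rho Z).
  rewrite cmod_gt0 one_sub_neq0 // normcM w1 mul1r.
  by apply: cmod_fold_disc_lt1 => //; exact: zs_rho.
by rewrite cmod_sub_fold_disc // lnM ?posrE // addrC.
Qed.

(** This is Jensen's inequality: the mean of [ln |p|] over the circle is at
    most its upper bound [L]. *)
Lemma excess_ge0 : 0 <= excess.
Proof.
have := le_trans (cmod_ge0 _) (folded_power_sum_le (ltn0Sn 0)).
by rewrite mulr1 pmulr_rge0.
Qed.

Lemma excess_le : excess <= L - ln (cmod a).
Proof.
rewrite /excess lerBlDr lerDl; apply: sumr_ge0 => Z _; apply: ln_ge0.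
by rewrite le_max rho1.
Qed.

Lemma sum_count (b : pred R[i]) :
  (count b zs)%:R = \sum_(Z <- zs) (b Z)%:R :> R.
Proof.
rewrite -sum1_count natr_sum big_mkcond; apply: eq_bigr => Z _.
by case: (b Z).
Qed.

(** Compare [ln |p 0|] with [excess >= 0] factor by factor: a zero of
    modulus at most [1 - delta] contributes at least [- ln (1 - delta) >= delta]
    to the difference and every other zero contributes something nonnegative. *)
Lemma count_small_disc_le (delta : R) : 0 < delta < 1 -> p.[0] != 0 ->
  delta * (count (fun Z => cmod Z <= 1 - delta) zs)%:R <= L - ln (cmod p.[0]).
Proof.
move=> /andP[d0 d1] p0.
have zn : 0 \notin zs.
  apply: contra p0 => h; rewrite /p hornerZ horner_prod (big_rem _ h) /=.
  by rewrite hornerXsubC subrr mul0r mulr0.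
rewrite ln_cmod_horner_roots //; have := excess_ge0; rewrite /excess.
suff : delta * (count (fun Z => cmod Z <= 1 - delta) zs)%:R <=
  \sum_(Z <- zs) ln (Num.max rho (cmod Z)) -
  \sum_(Z <- zs) ln (cmod (0 - Z)) by lra.
rewrite sum_count mulr_sumr -sumrB big_seq [leRHS]big_seq.
apply: ler_sum => Z Zs.
have Z0 : 0 < cmod Z by rewrite cmod_gt0; apply: contraNneq zn => <-.
rewrite sub0r normcN.
have mx : 1 <= Num.max rho (cmod Z) by rewrite le_max rho1.
case: (boolP (cmod Z <= 1 - delta)) => [Zd|_]; last first.
  rewrite /= mulr0n mulr0 subr_ge0.
  by rewrite ler_ln ?posrE ?le_max ?lexx ?orbT // (lt_le_trans ltr01).
rewrite /= mulr1n mulr1 -[leLHS]add0r -[delta]opprK lerB ?ln_ge0 //.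
have -> : cmod Z = 1 + (cmod Z - 1) by ring.
apply: le_trans (le_ln1Dx _) _; [lra|lra].
Qed.

(** Each zero counted on the left has Poisson kernel at least
    [1 / ((C + 2)^2 delta)]: folding moves it by at most [delta], since
    [rho <= 1 + delta], and replacing [1 - conjc v * y] by
    [1 - (1 - delta) * conjc v * y] costs another [delta]. *)
Lemma count_near_unit_point_le (delta C : R) v :
  0 < delta < 1 -> 0 <= C -> cmod v = 1 -> rho <= 1 + delta ->
  (count (fun Z => (cmod Z <= 1) && (cmod (Z - v) <= C * delta)) zs)%:R <=
  (C + 2) ^+ 2 * (3 * (size zs)%:R * delta + 4 * (L - ln (cmod a)) / delta).
Proof.
move=> /andP[d0 d1] C0 v1 rd.
have C2 : 0 < (C + 2) ^+ 2 by rewrite exprn_gt0 // ltr_wpDl.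
set y := fun Z => fold_disc rho Z.
have := @sum_poisson_le _ [seq y Z | Z <- zs] excess (1 - delta) (conjc v).
rewrite cmodJ size_map big_map => /(_ v1).
have -> : 1 - (1 - delta) = delta by ring.
have [r0 r1] : 0 <= 1 - delta /\ 1 - delta < 1 by split; lra.
have y1 : {in [seq y Z | Z <- zs], forall u, cmod u < 1}.
  by move=> u /mapP[Z Zs ->]; apply: cmod_fold_disc_lt1 => //; exact: zs_rho.
move=> /(_ r0 r1 y1 folded_power_sum_le).
set S := \sum_(Z <- zs) _ => hS.
have : (count (fun Z => (cmod Z <= 1) && (cmod (Z - v) <= C * delta)) zs)%:R <=
    (C + 2) ^+ 2 * delta * S.
  rewrite sum_count /S mulr_sumr big_seq [leRHS]big_seq; apply: ler_sum => Z Zs.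
  have yZ1 : cmod (y Z) < 1 by apply: y1; apply: map_f.
  set r := 1 - delta in hS r0 r1 *.
  have ry : (r * cmod (y Z)) ^+ 2 <= r.
    apply: le_trans (_ : r * cmod (y Z) <= _); last by rewrite ler_piMr // ltW.
    by rewrite expr2 ler_piMr ?mulr_ge0 ?cmod_ge0 // mulr_ile1 ?cmod_ge0 // ltW.
  have num : delta <= 1 - (r * cmod (y Z)) ^+ 2 by move: ry; rewrite /r; lra.
  have den0 : 0 < cmod (1 - r%:C * conjc v * y Z).
    rewrite cmod_gt0 one_sub_neq0 // !normcM cmodJ v1 mulr1 cmodC ger0_norm //.
    by rewrite mulr_ilt1 ?cmod_ge0.
  case: (boolP ((cmod Z <= 1) && (cmod (Z - v) <= C * delta))) =>
    [/andP[Z1 Zv]|_]; last first.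
    rewrite /= mulr0n mulr_ge0 //; first by rewrite mulr_ge0 ?sqr_ge0 // ltW.
    by rewrite divr_ge0 ?sqr_ge0 // (le_trans (ltW d0)).
  rewrite /= mulr1n mulrA ler_pdivlMr ?exprn_gt0 // mul1r.
  apply: le_trans (_ : ((C + 2) * delta) ^+ 2 <= _); last first.
    rewrite exprMn expr2 (expr2 delta) -!mulrA.
    by rewrite ler_pM2l ?ler_pM2l // -?expr2 ?ltr_wpDl.
  suff : cmod (1 - r%:C * conjc v * y Z) <= (C + 2) * delta.
    by move=> h; rewrite lerXn2r ?nnegrE ?cmod_ge0 // mulr_ge0 ?addr_ge0 // ltW.
  have -> : cmod (1 - r%:C * conjc v * y Z) =
      cmod ((v - Z) + (Z - y Z) + delta%:C * y Z).
    rewrite -[LHS]mul1r -v1 -normcM; congr (cmod _).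
    rewrite mulrBr mulr1 !mulrA (mulrAC v) mulcJ v1 expr1n mul1r.
    by rewrite /r rmorphB /=; ring.
  have ly : cmod (Z - y Z) <= delta.
    have -> : Z - y Z = (rho - 1)%:C * y Z.
      rewrite /y /fold_disc ifT; last exact: le_trans rho1.
      have rn : rho%:C != 0 :> R[i] by rewrite -cmod_gt0 cmodC gtr0_norm.
      by rewrite rmorphB /= rmorph1; field.
    rewrite normcM cmodC ger0_norm ?subr_ge0 //.
    apply: le_trans (_ : rho - 1 <= _); last by rewrite lerBlDl.
    by rewrite ler_piMr ?subr_ge0 // ltW.
  have ld : cmod (delta%:C * y Z) <= delta.
    by rewrite normcM cmodC gtr0_norm // ler_piMr ?ltW.
  apply: le_trans (le_normcD _ _) _.
  have -> : (C + 2) * delta = (C * delta + delta) + delta by ring.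
  rewrite lerD //; apply: le_trans (le_normcD _ _) _.
  by rewrite lerD // cmodB.
move=> h; apply: le_trans h _.
rewrite -mulrA ler_pM2l //.
apply: le_trans (_ : delta * (3 * (size zs)%:R + 4 * excess / delta ^+ 2) <= _).
  by rewrite ler_pM2l.
have -> : delta * (3 * (size zs)%:R + 4 * excess / delta ^+ 2) =
    3 * (size zs)%:R * delta + 4 * excess / delta.
  by field; rewrite gt_eqF.
by rewrite lerD2l ler_pM2r ?invr_gt0 // ler_pM2l ?excess_le.
Qed.
End Counting.

Section ZeroBound.
Context {R : realType}.
Implicit Types (v z Z : R[i]) (zs vs : seq R[i]).

(** Used to choose a circle just outside the unit circle which carries no
    zero and has no zero between it and the unit circle. *)
Lemma exists_modulus_gap zs :
  exists2 e : R, 0 < e & {in zs, forall Z, 1 < cmod Z -> 1 + e < cmod Z}.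
Proof.
elim: zs => [|Z zs [e e0 he]]; first by exists 1.
have [Z1|Z1] := leP (cmod Z) 1.
  exists e => // X; rewrite inE => /orP[/eqP->|/he //].
  by move=> /lt_le_trans /(_ Z1); rewrite ltxx.
exists (Num.min e ((cmod Z - 1) / 2)).
  by rewrite lt_min e0 divr_gt0 // subr_gt0.
move=> X; rewrite inE => /orP[/eqP->|/he h] X1.
  apply: le_lt_trans (_ : 1 + (cmod Z - 1) / 2 < _); last lra.
  by rewrite lerD2l ge_min lexx orbT.
by apply: le_lt_trans (h X1); rewrite lerD2l ge_min lexx.
Qed.

(** Both counts are applied on a circle of radius [rho > 1], strictly
    inside which lie all zeros of the closed unit disc; the zeros in [E] are
    then only rescaled by the folding. *)
Lemma zeros_in_set_le (a : R[i]) zs vs (E : set R[i]) (M delta C : R) :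
  let p := a *: \prod_(Z <- zs) ('X - Z%:P) in
  let L := ln M + 1 in
  a != 0 -> p.[0] != 0 -> (0 < size zs)%N -> 0 < M ->
  (forall z, 1 <= cmod z -> cmod p.[z] <= M * cmod z ^+ size zs) ->
  0 < delta < 1 -> 0 <= C -> {in vs, forall v, cmod v = 1} ->
  (forall z, E z -> cmod z <= 1) ->
  (forall z, E z -> 1 - delta < cmod z ->
    exists2 v, v \in vs & cmod (z - v) <= C * delta) ->
  \sum_(Z <- zs) (\1_E Z : R) <=
  (L - ln (cmod p.[0])) / delta +
  (size vs)%:R * ((C + 2) ^+ 2 *
    (3 * (size zs)%:R * delta + 4 * (L - ln (cmod a)) / delta)).
Proof.
move=> p L a0 p0 n0 M0 pM d01 C0 vs1 E1 EC; have [d0 d1] := andP d01.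
set n := size zs in n0 pM *.
have nR : 0 < n%:R :> R by rewrite ltr0n.
have [e e0 he] := exists_modulus_gap zs.
(* the bound 1 / n gives n ln (1 + eta) <= 1, so passing from the unit circle
   to the circle of radius rho adds at most 1 to the bound for ln |p| *)
pose eta := Num.min e (Num.min delta n%:R^-1).
have eta0 : 0 < eta by rewrite !lt_min e0 d0 invr_gt0.
have eta_e : eta <= e by rewrite ge_min lexx.
have eta_d : eta <= delta by rewrite !ge_min lexx orbT.
have eta_n : eta <= n%:R^-1 by rewrite !ge_min lexx !orbT.
pose rho := 1 + eta.
have rho1 : 1 <= rho by rewrite lerDl ltW.
have rho0 : 0 < rho := lt_le_trans ltr01 rho1.
have zr : {in zs, forall Z, cmod Z != rho}.
  move=> Z Zs; have [h|h] := leP (cmod Z) 1.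
    by rewrite lt_eqF // (le_lt_trans h) // ltrDl.
  by rewrite gt_eqF // (le_lt_trans _ (he _ Zs h)) // lerD2l.
have pL z : cmod z = rho -> ln (cmod p.[z]) <= L.
  move=> zrho; have z1 : 1 <= cmod z by rewrite zrho.
  have h := pM z z1; have pz : p.[z] != 0.
    apply/negP => /eqP/eqP; rewrite -/(root p z) rootZ // root_prod_XsubC.
    by move=> /zr; rewrite zrho eqxx.
  apply: le_trans (_ : ln (M * cmod z ^+ n) <= _).
    rewrite ler_ln ?posrE ?cmod_gt0 //.
    by rewrite mulr_gt0 ?exprn_gt0 // (lt_le_trans ltr01).
  rewrite zrho /L lnM ?posrE ?exprn_gt0 ?rho0 //.
  rewrite lerD2l lnXn //.
  rewrite -[_ *+ n]mulr_natl; apply: le_trans (_ : n%:R * n%:R^-1 <= _);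
    last by rewrite mulfV ?gt_eqF.
  rewrite ler_pM2l //; apply: le_trans eta_n; apply: le_ln1Dx.
  by rewrite (lt_le_trans _ (ltW eta0)) // ltrN10.
have small := count_small_disc_le a0 rho1 zr pL d01 p0.
have near v : v \in vs -> _ :=
  fun h => count_near_unit_point_le a0 rho1 zr pL d01 C0 (vs1 v h) _.
apply: le_trans (_ : (count (fun Z => cmod Z <= 1 - delta) zs)%:R +
   \sum_(v <- vs) (count (fun Z => (cmod Z <= 1) &&
                            (cmod (Z - v) <= C * delta)) zs)%:R <= _).
  rewrite sum_count; under [X in _ <= _ + X]eq_bigr => v _ do rewrite sum_count.
  rewrite exchange_big -big_split /=; apply: ler_sum => Z _.
  rewrite indicE; case: (boolP (Z \in E)) => [|_]; last first.
    by rewrite addr_ge0 // sumr_ge0.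
  rewrite inE => EZ; have [h|h] := leP (cmod Z) (1 - delta).
    by rewrite /= lerDl sumr_ge0.
  have [v vvs hv] := EC Z EZ h.
  by rewrite /= add0r (big_rem v) //= hv E1 //= lerDl sumr_ge0.
apply: lerD.
  by rewrite ler_pdivlMr // mulrC.
rewrite mulr_natl -iter_addr_0 -(count_predT vs) -big_const_seq.
rewrite big_seq [leRHS]big_seq.
by apply: ler_sum => v /near; apply; rewrite lerD2l.
Qed.

End ZeroBound.

(** * Inscribed polygons near the circle *)

Section Geometry.
Context {R : realType}.
Implicit Types (u z w : R[i]).

(** The codomain carries the norm topology of the complex numbers, in which
    components are taken. *)
Lemma continuous_ray z u :
  continuous ((fun s : R => z + s%:C * u) : R -> R[i]^o).
Proof.
move=> s; apply/cvgrPdist_le => /= e e0.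
have [eR e0'] : (complex.Re e)%:C = e /\ 0 < complex.Re e.
  move: e0; rewrite ltcE /= => /andP[/eqP ei er]; split=> //.
  by case: e ei {er} => a b /= ->.
have k0 : 0 < 1 + cmod u by rewrite ltr_wpDr ?cmod_ge0.
near=> t; rewrite -eR -cmod_norm lecR.
have -> : z + s%:C * u - (z + t%:C * u) = (s - t)%:C * u.
  by rewrite rmorphB /=; ring.
rewrite normcM cmodC; apply: le_trans (_ : `|s - t| * (1 + cmod u) <= _).
  by rewrite ler_wpM2l // lerDr.
rewrite -ler_pdivlMr //; near: t.
by apply: cvgr_dist_le; [exact: cvg_id|rewrite divr_gt0].
Unshelve. all: by end_near. Qed.

Lemma bounded_cmod (A : set R[i]^o) :
  bounded_set A -> exists b : R, forall z, A z -> cmod z <= b.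
Proof.
move=> [M [Mr hM]]; exists (complex.Re M + 1) => z Az.
rewrite -lecR cmod_norm; apply: hM => //.
by rewrite -{1}(RRe_real Mr) ltcR ltrDl.
Qed.

Lemma segment_half_plane u (b : R) z1 z2 z :
  complex.Re (conjc u * z1) <= b -> complex.Re (conjc u * z2) <= b ->
  segment z1 z2 z -> complex.Re (conjc u * z) <= b.
Proof.
move=> h1 h2 [t]; rewrite /= in_itv /= => /andP[t0 t1] <-.
have [tE tau0 tau1] :
    [/\ t = (complex.Re t)%:C, 0 <= complex.Re t & complex.Re t <= 1].
  move: t0 t1; rewrite !lecE => /andP[/eqP ti tr] /andP[_ tr']; split => //.
  by case: t ti {tr tr'} => x y /= ->.
move: (complex.Re t) tE tau0 tau1 => tau -> tau0 tau1; rewrite /line_path.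
have -> : conjc u * ((1 - tau%:C) * z1 + tau%:C * z2) =
    (1 - tau)%:C * (conjc u * z1) + tau%:C * (conjc u * z2).
  by rewrite rmorphB /= rmorph1; ring.
rewrite ReD !ReZ.
have -> : b = (1 - tau) * b + tau * b by ring.
by rewrite lerD // ler_wpM2l // subr_ge0.
Qed.

(** From a point beyond the supporting line the ray in direction [u]
    never meets the chain, so the component of that point is unbounded. *)
Lemma region_half_plane m (v : 'I_m -> R[i]) u (b : R) z : u != 0 ->
  (forall i, complex.Re (conjc u * v i) <= b) -> region v z ->
  complex.Re (conjc u * z) <= b.
Proof.
move=> u0 hv; have hchain w : chain v w -> complex.Re (conjc u * w) <= b.
  by move=> [i _]; apply: segment_half_plane.
case=> [|[zc zb]]; first exact: hchain.
rewrite leNgt; apply/negP => bz.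
pose f (s : R) : R[i]^o := z + s%:C * u.
have fE s :
    complex.Re (conjc u * f s) = complex.Re (conjc u * z) + s * cmod u ^+ 2.
  have -> : conjc u * f s = conjc u * z + s%:C * (u * conjc u).
    by rewrite /f; ring.
  by rewrite mulcJ ReD ReZ.
have sub : f @` [set s | 0 <= s] `<=`
    connected_component (~` chain v : set R[i]^o) z.
  apply: connected_component_max.
  - by exists 0 => //=; rewrite /f mul0r addr0.
  - move=> _ [s /= s0 <-] /hchain; rewrite fE leNgt => /negP; apply.
    by rewrite (lt_le_trans bz) // lerDl mulr_ge0 ?exprn_ge0 ?cmod_ge0.
  - apply: connected_continuous_connected.
      apply/connected_intervalP => x y /= x0 y0 t /andP[xt _].
      exact: le_trans xt.
    by apply: continuous_subspaceT; exact: continuous_ray.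
have [B hB] := bounded_cmod zb.
have up : 0 < cmod u by rewrite cmod_gt0.
pose s := (`|B| + cmod z + 1) / cmod u.
have s0 : 0 <= s by rewrite divr_ge0 ?cmod_ge0 // !addr_ge0 ?cmod_ge0.
have : cmod (f s) <= B by apply: hB; apply: sub; exists s.
apply/negP; rewrite -ltNge.
have : cmod (s%:C * u) <= cmod (f s) + cmod z.
  have -> : s%:C * u = f s - z by rewrite /f; ring.
  by apply: le_trans (le_normcD _ _) _; rewrite normcN.
rewrite normcM cmodC ger0_norm // /s mulfVK ?gt_eqF //.
by have := ler_norm B; lra.
Qed.

Lemma exists_separation m (v : 'I_m -> R[i]) : injective v ->
  exists2 D : R, 0 < D <= 1 & forall i j, i != j -> D <= cmod (v i - v j).
Proof.
move=> iv; exists (\big[Num.min/1]_(p : 'I_m * 'I_m | p.1 != p.2)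
  cmod (v p.1 - v p.2)).
  rewrite bigmin_le_id andbT; apply: lt_bigmin => // p pn.
  by rewrite cmod_gt0 subr_eq0; apply: contra pn => /eqP/iv ->.
by move=> i j ij; exact: (@bigmin_le_cond _ _ _ _ (i, j)).
Qed.

Lemma cmod_sub_sqr_unit u w : cmod u = 1 -> cmod w = 1 ->
  cmod (w - u) ^+ 2 = 2 * (1 - complex.Re (conjc u * w)).
Proof.
move=> u1 w1; have: cmod u ^+ 2 = 1 by rewrite u1 expr1n.
have: cmod w ^+ 2 = 1 by rewrite w1 expr1n.
rewrite !cmod_sqr; case: u {u1} => a b; case: w {w1} => c d /= h1 h2.
transitivity ((c ^+ 2 + d ^+ 2) + (a ^+ 2 + b ^+ 2) - 2 * (a * c + b * d)).
  by ring.
by rewrite h1 h2; ring.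
Qed.

(** Put [u = z / |z|].  If no vertex is close to [u], the line orthogonal
    to [u] cuts off a cap of fixed height free of vertices, so [z] is not near
    the circle.  Otherwise a single vertex [v i] is close to [u], the others
    being a fixed distance away, and the line through [v i] may be tilted by a
    fixed slope [k] without meeting them.  With the tilt turned so as to cut off
    [u], the point [z] can lie on the inner side only if its depth [1 - |z|] is
    at least [k] times the height of [v i] over the axis of [u]. *)
Lemma region_near_vertex m (v : 'I_m -> R[i]) : injective v ->
  (forall i, cmod (v i) = 1) ->
  exists C delta0 : R, [/\ 0 <= C, 0 < delta0 < 1,
    forall z, region v z -> cmod z <= 1 &
    forall z delta, region v z -> 0 < delta <= delta0 -> 1 - delta < cmod z ->
      exists i, cmod (z - v i) <= C * delta].
Proof.
move=> iv v1; have [D /andP[D0 D1] hD] := exists_separation iv.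
(* small enough that a vertex at distance at least D / 2 from u, whose
   projection on u is at most 1 - 4 k, stays below the tilted line *)
pose k := D ^+ 2 / 32.
have D2 : D ^+ 2 = 32 * k by rewrite /k; field.
have D21 : D ^+ 2 <= D by rewrite expr2 ler_piMr // ltW.
have k0 : 0 < k by rewrite divr_gt0 ?exprn_gt0.
have kk : k ^+ 2 <= k / 32 by rewrite expr2; nra.
exists (1 + 2 / k), (k ^+ 2 / 2); split.
- by rewrite addr_ge0 // divr_ge0 // ltW.
- by rewrite divr_gt0 ?exprn_gt0 //=; lra.
- move=> z vz; have [->|z0] := eqVneq z 0; first by rewrite cmod0.
  have := region_half_plane z0 (b := cmod z) _ vz.
  rewrite mulrC mulcJ /= expr2 => h.
  have zp : 0 < cmod z by rewrite cmod_gt0.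
  rewrite -(ler_pM2l zp) mulr1.
  apply: h => i; apply: le_trans (Re_le_cmod _) _.
  by rewrite normcM cmodJ v1 mulr1.
move=> z delta vz /andP[d0 dd] zd.
have zp : 0 < cmod z by apply: le_lt_trans zd; rewrite subr_ge0; lra.
pose u := ((cmod z)^-1)%:C * z.
have u1 : cmod u = 1.
  by rewrite normcM cmodC gtr0_norm ?invr_gt0 // mulVf // gt_eqF.
have u0 : u != 0 := cmod1_neq0 u1.
have zu : z = (cmod z)%:C * u.
  by rewrite /u mulrA -rmorphM /= divff ?mul1r ?gt_eqF.
have uz : complex.Re (conjc u * z) = cmod z.
  rewrite {1}zu mulrCA (mulrC (conjc u)) mulcJ u1 expr1n ReZ mulr1 //.
pose x i := complex.Re (conjc u * v i); pose y i := complex.Im (conjc u * v i).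
have xy i : x i ^+ 2 + y i ^+ 2 = 1.
  by rewrite -cmod_sqr normcM cmodJ u1 v1 mul1r expr1n.
have xE i : cmod (v i - u) ^+ 2 = 2 * (1 - x i) := cmod_sub_sqr_unit u1 (v1 i).
have [[i vi]|far] := pselect (exists i, cmod (v i - u) <= k); last first.
  have := region_half_plane u0 (b := 1 - k ^+ 2 / 2) _ vz.
  rewrite uz => h; have : cmod z <= 1 - k ^+ 2 / 2; last lra.
  apply: h => i; have : k <= cmod (v i - u).
    by rewrite leNgt; apply/negP => hi; apply: far; exists i; exact: ltW.
  move=> hk; have : k ^+ 2 <= cmod (v i - u) ^+ 2.
    by rewrite lerXn2r ?nnegrE ?cmod_ge0 // ltW.
  by rewrite xE /x; lra.
exists i.
have y1 j : `|y j| <= 1.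
  rewrite -(@ler_pXn2r _ 2) ?nnegrE // real_normK ?num_real // expr1n.
  by rewrite -(xy j) lerDr sqr_ge0.
have vi2 : cmod (v i - u) ^+ 2 <= k ^+ 2.
  by rewrite lerXn2r ?nnegrE ?cmod_ge0 // ltW.
have xi : 1 - k ^+ 2 / 2 <= x i by move: vi2; rewrite xE; lra.
have yi2 : `|y i| ^+ 2 <= k ^+ 2.
  rewrite real_normK ?num_real //; have := xy i; move: vi2; rewrite xE.
  have : x i <= 1 by have := sqr_ge0 (cmod (v i - u)); rewrite xE; lra.
  by move: xi kk k0; nra.
have yi : `|y i| <= k.
  by move: yi2; rewrite ler_pXn2r ?nnegrE // ltW.
pose sg : R := if 0 <= y i then 1 else -1.
have sgy : sg * y i = `|y i|.
  rewrite /sg; case: (leP 0 (y i)) => h; first by rewrite mul1r ger0_norm.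
  by rewrite mulN1r ltr0_norm.
have sgn t : - (k * (sg * t)) <= k * `|t|.
  rewrite -mulrN ler_pM2l // /sg; case: ifP => _;
    rewrite ?mul1r ?mulN1r ?opprK ?ler_norm //.
  by rewrite -normrN ler_norm.
(* the normal of the tilted line *)
pose a := u * (1 -i* (k * sg)).
have a0 : a != 0.
  by rewrite mulf_neq0 // eq_complex /= oner_eq0.
have aE w : complex.Re (conjc a * w) =
    complex.Re (conjc u * w) - k * (sg * complex.Im (conjc u * w)).
  rewrite /a; case: (u) => ? ?; case: w => ? ? /=; ring.
have key : complex.Re (conjc a * z) <= x i - k * `|y i|.
  apply: region_half_plane vz => // j; rewrite aE -/(x j) -/(y j).
  have [->|ji] := eqVneq j i; first by rewrite sgy.
  have := hD j i ji => Dji.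
  have hj : D / 2 <= cmod (v j - u).
    have : cmod (v j - v i) <= cmod (v j - u) + cmod (v i - u).
      rewrite (cmodB (v i)); apply: le_trans (le_normcD _ _).
      by rewrite addrA subrK.
    by move: vi kk; rewrite -/k; lra.
  have : (D / 2) ^+ 2 <= cmod (v j - u) ^+ 2.
    by rewrite lerXn2r ?nnegrE ?cmod_ge0 // divr_ge0 // ltW.
  rewrite xE exprMn D2 => xj.
  have := sgn (y j); have : k * `|y j| <= k by rewrite ler_piMr // ltW.
  have : k * `|y i| <= k ^+ 2 by rewrite expr2 ler_pM2l.
  by move: xi xj kk; rewrite expr2; lra.
have zi : complex.Im (conjc u * z) = 0.
  by rewrite {1}zu mulrCA (mulrC (conjc u)) mulcJ u1 expr1n /=; ring.
rewrite aE uz zi !mulr0 subr0 in key.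
have x1 : x i <= 1 by have := sqr_ge0 (cmod (v i - u)); rewrite xE; lra.
have yd : `|y i| <= delta / k by rewrite ler_pdivlMr // mulrC; lra.
have vy : cmod (v i - u) <= 2 * `|y i|.
  rewrite -(@ler_pXn2r _ 2) ?nnegrE ?cmod_ge0 ?mulr_ge0 // exprMn.
  rewrite real_normK ?num_real // xE.
  have := xy i; move: xi x1 kk; nra.
have zu1 : cmod (z - u) <= delta.
  have -> : z - u = (cmod z - 1)%:C * u.
    by rewrite rmorphB /= rmorph1 mulrBl mul1r -zu.
  rewrite normcM u1 mulr1 cmodC ler_norml.
  have ky : 0 <= k * `|y i| by rewrite mulr_ge0 // ltW.
  by apply/andP; split; lra.
have -> : z - v i = (z - u) - (v i - u) by ring.
apply: le_trans (le_normcD _ _) _; rewrite normcN.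
have -> : (1 + 2 / k) * delta = delta + 2 * (delta / k).
  by field; rewrite gt_eqF.
by rewrite lerD // (le_trans vy) // ler_pM2l.
Qed.
End Geometry.

(** * Zeros in an inscribed polygon *)

Section PolygonCount.
Context {R : realType}.

Lemma zeros_poly n (A : nat -> R[i]) : A n != 0 ->
  let p := \poly_(k < n.+1) A k in
  p = A n *: \prod_(z <- zeros p) ('X - z%:P) /\ size (zeros p) = n.
Proof.
move=> An0 p; have sp : size p = n.+1 by rewrite size_poly_eq.
have lp : lead_coef p = A n by rewrite lead_coef_poly.
have p0 : p != 0 by rewrite -size_poly_gt0 sp.
have e : p = A n *: \prod_(z <- zeros p) ('X - z%:P).
  rewrite -lp /zeros (negbTE p0); exact: (svalP (closed_field_poly_normal p)).
split=> //; have := congr1 (size \o val) e.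
by rewrite /= sp size_scale // size_prod_XsubC => -[].
Qed.

Lemma cmod_poly_le n (A : nat -> R[i]) (z : R[i]) : 1 <= cmod z ->
  cmod (\poly_(k < n.+1) A k).[z] <= (\sum_(k < n.+1) cmod (A k)) * cmod z ^+ n.
Proof.
move=> z1; rewrite horner_poly; apply: le_trans (cmod_sum _ _) _.
rewrite mulr_suml; apply: ler_sum => k _; rewrite normcM cmodX.
by rewrite ler_wpM2l ?cmod_ge0 // ler_weXn2l // -ltnS.
Qed.

(** The deterministic count.  Zeros of modulus at most [1 - delta] are
    charged to [A 0] and zeros near the vertices to [A n]; the constant 2 is the
    loss, 1 for each of them, from working on a circle of radius slightly larger
    than 1. *)
Lemma polygon_zero_count (E : set R[i]) : inscribed_polygon E ->
  exists K delta0 : R, [/\ 0 < K, 0 < delta0 &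
    forall n (A : nat -> R[i]) (delta M : R),
      (0 < n)%N -> A 0%N != 0 -> A n != 0 ->
      0 < delta <= delta0 -> \sum_(k < n.+1) cmod (A k) <= M ->
      n%:R * zero_counting n (\poly_(k < n.+1) A k) E <=
      K * (n%:R * delta +
           (2 * ln M + 2 - ln (cmod (A 0%N)) - ln (cmod (A n))) / delta)].
Proof.
move=> [m [v [[_ iv _] v1 ->]]].
have [C [delta0 [C0 /andP[d00 d01] E1 EC]]] := region_near_vertex iv v1.
pose Q := m%:R * (4 * (C + 2) ^+ 2) : R.
have Q0 : 0 <= Q by rewrite mulr_ge0 // mulr_ge0 // sqr_ge0.
exists (1 + Q), delta0; split => //; first by rewrite ltr_pwDl.
move=> n A delta M n0 A0 An /andP[d0 dd] AM.
have nR : 0 < n%:R :> R by rewrite ltr0n.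
have [pE sz] := zeros_poly An; set p := \poly_(k < n.+1) A k in pE sz *.
have M_ge k : (k <= n)%N -> cmod (A k) <= M.
  rewrite -ltnS => kn; apply: le_trans AM.
  rewrite (bigD1 (Ordinal kn)) //= lerDl sumr_ge0 // => i _.
  exact: cmod_ge0.
have cA0 : 0 < cmod (A 0%N) by rewrite cmod_gt0.
have cAn : 0 < cmod (A n) by rewrite cmod_gt0.
have M0 : 0 < M by apply: lt_le_trans (M_ge 0%N _).
have p0 : p.[0] = A 0%N by rewrite horner_coef0 coef_poly.
have lM0 : ln (cmod (A 0%N)) <= ln M by rewrite ler_ln ?posrE // M_ge.
have lMn : ln (cmod (A n)) <= ln M by rewrite ler_ln ?posrE // M_ge.
have := @zeros_in_set_le _ (A n) (zeros p) [seq v i | i <- enum 'I_m]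
  (region v) M delta C An.
rewrite -pE sz p0 size_map size_enum_ord => /(_ A0 n0 M0).
have pM z : 1 <= cmod z -> cmod p.[z] <= M * cmod z ^+ n.
  move=> z1; apply: le_trans (cmod_poly_le _ _ z1) _.
  by rewrite ler_wpM2r ?exprn_ge0 ?cmod_ge0.
move=> /(_ pM); have -> : 0 < delta < 1 by rewrite d0 (le_lt_trans dd).
move=> /(_ isT C0).
have vs1 : {in [seq v i | i <- enum 'I_m], forall w, cmod w = 1}.
  by move=> _ /mapP[i _ ->]; exact: v1.
have vsC z : region v z -> 1 - delta < cmod z ->
    exists2 w, w \in [seq v i | i <- enum 'I_m] & cmod (z - w) <= C * delta.
  move=> vz zd; have [|i hi] := EC z delta vz _ zd; first by rewrite d0.
  by exists (v i) => //; rewrite map_f ?mem_enum.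
move=> /(_ vs1 E1 vsC) h.
rewrite /zero_counting mulrA mulfV ?gt_eqF // mul1r; apply: le_trans h _.
set a := ln (cmod (A 0%N)) in lM0 *; set b := ln (cmod (A n)) in lMn *.
set L := ln M in lM0 lMn *.
have di : 0 < delta^-1 by rewrite invr_gt0.
rewrite -subr_ge0; set X := (X in 0 <= X).
have -> : X = n%:R * delta + Q * (n%:R * delta / 4) + (L + 1 - b) / delta +
    Q * ((L + 1 - a) / delta).
  by rewrite /X /Q; field; rewrite gt_eqF.
have [ha hb] : 0 <= L + 1 - a /\ 0 <= L + 1 - b by split; lra.
have nd : 0 <= n%:R * delta by rewrite mulr_ge0 // ltW.
have qa : 0 <= (L + 1 - a) / delta by rewrite divr_ge0 // ltW.
have qb : 0 <= (L + 1 - b) / delta by rewrite divr_ge0 // ltW.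
rewrite addr_ge0 ?(mulr_ge0 Q0) // addr_ge0 // addr_ge0 // mulr_ge0 //.
by rewrite divr_ge0.
Qed.
End PolygonCount.

(** * Logarithmic moments *)

Section Analysis.
Context {R : realType}.

Lemma ln_le_div_add (x c : R) : 0 < x -> 0 < c -> ln x <= x / c + ln c.
Proof.
move=> x0 c0; have := ltW (ln_sublinear (divr_gt0 x0 c0)).
by rewrite ln_div ?posrE // lerBlDr.
Qed.

(** Each term is at most the power [t^-1] of the sum on the right; this
    treats [t < 1] and [t >= 1] alike. *)
Lemma sum_le_powR_sum n (c : 'I_n -> R) (t : R) :
  0 < t -> (forall k, 0 <= c k) ->
  \sum_k c k <= n%:R * (\sum_k c k `^ t) `^ t^-1.
Proof.
move=> t0 c0; set S := \sum_k _ `^ t.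
have h k : c k <= S `^ t^-1.
  have {1}-> : c k = (c k `^ t) `^ t^-1.
    by rewrite -powRrM mulfV ?gt_eqF // powRr1.
  apply: ge0_ler_powR; rewrite ?nnegrE ?invr_ge0 ?powR_ge0 ?(ltW t0) //.
    by rewrite sumr_ge0 // => i _; rewrite powR_ge0.
  by rewrite /S (bigD1 k) //= lerDl sumr_ge0 // => i _; rewrite powR_ge0.
apply: le_trans (_ : \sum_(k < n) S `^ t^-1 <= _); first exact: ler_sum.
by rewrite sumr_const card_ord -(mulr_natl (S `^ _)).
Qed.

(** The positive part of the logarithm is controlled by any moment. *)
Lemma lne_le_powR (x t : R) :
  0 <= x -> 0 < t -> (lne x%:E <= (x `^ t / t)%:E)%E.
Proof.
move=> x0 t0; rewrite le_eqVlt in x0; case/orP: x0 => [/eqP<-|x0].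
  by rewrite le0_lneNy // leNye.
rewrite lne_EFin // lee_fin ler_pdivlMr // mulrC -ln_powR.
by apply/ltW/ln_sublinear; rewrite powR_gt0.
Qed.

(** From [ln n = 2 ln (sqrt n) <= 2 sqrt n]. *)
Lemma near_sqrt_ln_div_le (d : R) : 0 < d ->
  \forall n \near \oo, Num.sqrt (ln n%:R / n%:R) <= d.
Proof.
move=> d0; near=> n.
have n0 : 0 < n%:R :> R by rewrite ltr0n; near: n; exact: nbhs_infty_gt.
rewrite [leRHS](_ : d = Num.sqrt (d ^+ 2)); last by rewrite sqrtr_sqr gtr0_norm.
apply: ler_wsqrtr; rewrite ler_pdivrMr //.
have s0 : 0 < Num.sqrt n%:R :> R by rewrite sqrtr_gt0.
have ss : n%:R = Num.sqrt n%:R ^+ 2 :> R by rewrite sqr_sqrtr // ltW.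
rewrite {1}ss lnXn // -[ln _ *+ 2]mulr_natl.
apply: le_trans (_ : 2 * Num.sqrt n%:R <= _).
  by rewrite ler_pM2l //; apply/ltW/ln_sublinear.
have : 2 / d ^+ 2 <= Num.sqrt n%:R.
  have e : 2 / d ^+ 2 = Num.sqrt ((2 / d ^+ 2) ^+ 2).
    by rewrite sqrtr_sqr ger0_norm // divr_ge0 // exprn_ge0 // ltW.
  rewrite e; apply: ler_wsqrtr; near: n; exact: nbhs_infty_ger.
rewrite ler_pdivrMr ?exprn_gt0 // => h.
by rewrite {2}ss expr2 mulrA ler_pM2r // mulrC.
Unshelve. all: by end_near. Qed.

Lemma exists_real_upper_bound (x : \bar R) :
  (x < +oo)%E -> exists2 b : R, 0 <= b & (x <= b%:E)%E.
Proof.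
case: x => [r _| // |_]; last by exists 0 => //; exact: leNye.
by exists `|r|; rewrite ?normr_ge0 // lee_fin ler_norm.
Qed.

End Analysis.

Section Integrals.
Context {d : measure_display} {T : measurableType d} {R : realType}.
Context (P : probability T R).

(** The integral of a nonnegative function is a supremum over the simple
    functions below it, so monotonicity holds without measurability.  It is
    applied to the number of zeros in a set. *)
Lemma integral_mono_nonneg (f g : T -> \bar R) :
  (forall w, 0 <= f w)%E -> (forall w, f w <= g w)%E ->
  (\int[P]_w f w <= \int[P]_w g w)%E.
Proof.
move=> f0 fg; have g0 w : (0 <= g w)%E := le_trans (f0 w) (fg w).
rewrite !ge0_integralTE //; apply: le_ereal_sup => _ [h /= hf <-].
by exists h => // w; apply: le_trans (fg w).
Qed.

Variable X : T -> R[i].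
Hypothesis mX : complex_random_variable X.

Lemma measurable_cmod : measurable_fun setT (fun w => cmod (X w)).
Proof.
have [mRe mIm] := mX.
have -> : (fun w => cmod (X w)) =
    (fun w => Num.sqrt (complex.Re (X w) ^+ 2 + complex.Im (X w) ^+ 2)).
  by apply/funext => w; case: (X w).
apply: (measurableT_comp (continuous_measurable_fun (@sqrt_continuous R))).
by apply: measurable_funD; apply: measurable_funX.
Qed.

Lemma measurable_lne_cmod : measurable_fun setT (fun w => lne (cmod (X w))%:E).
Proof.
have -> : (fun w => lne (cmod (X w))%:E) =
    (fun w => if cmod (X w) == 0 then -oo%E else (ln (cmod (X w)))%:E).
  apply/funext => w; case: eqP => [->|/eqP w0]; first by rewrite le0_lneNy.
  by rewrite lne_EFin // lt_neqAle eq_sym w0 cmod_ge0.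
apply: measurable_fun_ifT => //.
  apply: measurable_fun_eqr => //; exact: measurable_cmod.
apply/measurable_EFinP; apply: measurableT_comp => //; exact: measurable_cmod.
Qed.

Variable t : R.
Hypothesis t0 : 0 < t.
Hypothesis fin : ('E_P[fun w => (cmod (X w) `^ t)%R] < +oo)%E.

Lemma integrable_cmod_powR :
  P.-integrable setT (fun w => (cmod (X w) `^ t)%R%:E).
Proof.
apply/integrableP; split.
  apply/measurable_EFinP; apply: (measurableT_comp (measurable_powR _)) => //.
  exact: measurable_cmod.
move: fin; rewrite unlock; apply: le_lt_trans.
by under eq_integral => w _ do rewrite gee0_abs ?lee_fin ?powR_ge0 //.
Qed.

(** The positive part is integrable by the moment bound, and then the
    integral can exceed [-oo] only if the negative part is integrable too. *)
Lemma integrable_lne_cmod : (-oo < \int[P]_w lne (cmod (X w))%:E)%E ->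
  P.-integrable setT (fun w => lne (cmod (X w))%:E).
Proof.
set f := fun w => lne (cmod (X w))%:E => h.
have mf : measurable_fun setT f := measurable_lne_cmod.
have pos : (\int[P]_w (f^\+ w) < +oo)%E.
  apply: le_lt_trans
    (_ : \int[P]_w ((t^-1)%R%:E * (cmod (X w) `^ t)%R%:E) < +oo)%E.
    apply: integral_mono_nonneg => [w|w]; first exact: funepos_ge0.
    rewrite -EFinM mulrC funeposE ge_max lne_le_powR ?cmod_ge0 //=.
    by rewrite lee_fin divr_ge0 ?powR_ge0 // ltW.
  have := integrableZl measurableT t^-1 integrable_cmod_powR.
  by move=> /integrable_lty -> //.
have neg : (\int[P]_w (f^\- w) < +oo)%E.
  move: h; rewrite integralE.
  rewrite ltey; apply: contraTneq => ->.
  by rewrite addeNy ltxx.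
apply/integrableP; split=> //.
under eq_integral => w _ do rewrite -[`|f w|%E]/((abse \o f) w) fune_abse.
rewrite ge0_integralD //; [exact: lte_add_pinfty| | ].
- exact: measurable_funepos.
- exact: measurable_funeneg.
Qed.
End Integrals.

(** * The expected number of zeros *)

Section Expectation.
Context {R : realType}.

(** With values in the extended reals the bound also covers the event that
    an end coefficient vanishes, where its right side is [+oo].  Otherwise apply
    the hypothesis to [M := n.+1 * S `^ t^-1], [S] being the sum of the [t]-th
    powers of the moduli, and linearize [ln S] at [n.+1]: this leaves a multiple
    of [S / n.+1], whose mean is bounded. *)
Lemma zero_count_lne_le (K delta t N : R) n (A : nat -> R[i]) :
  0 < K -> 0 < delta -> 0 < t ->
  (A 0%N != 0 -> A n != 0 -> forall M, \sum_(k < n.+1) cmod (A k) <= M ->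
    N <= K * (n%:R * delta +
              (2 * ln M + 2 - ln (cmod (A 0%N)) - ln (cmod (A n))) / delta)) ->
  (N%:E <= (K * (n%:R * delta + (2 + (2 + 2 / t) * ln n.+1%:R) / delta))%:E +
    (K / delta)%:E *
      ((2 / (t * n.+1%:R))%:E * (\sum_(k < n.+1) cmod (A k) `^ t)%:E
       - lne (cmod (A 0%N))%:E - lne (cmod (A n))%:E))%E.
Proof.
move=> K0 d0 t0 hN; set S := (\sum_(k < n.+1) _)%R.
have Kd : (0 < K / delta)%R by rewrite divr_gt0.
have lneNoo (x : R) : (- lne x%:E != -oo)%E.
  by rewrite /lne; case: ifP.
have top (x : R) : (x%:E + (K / delta)%:E * +oo = +oo)%E.
  by rewrite mulry gtr0_sg // mul1e.
have [A0|A0] := eqVneq (A 0%N) 0%R.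
  rewrite A0 cmod0 (le0_lneNy (lexx _)) (_ : - -oo = +oo)%E // -EFinM addey //.
  by rewrite addye ?lneNoo // top leey.
have [An|An] := eqVneq (A n) 0%R.
  rewrite An cmod0 (le0_lneNy (lexx _)) (_ : - -oo = +oo)%E // -EFinM.
  by rewrite lne_EFin ?cmod_gt0 // -EFinB addey // top leey.
have a0 : 0 < cmod (A 0%N) by rewrite cmod_gt0.
have an : 0 < cmod (A n) by rewrite cmod_gt0.
rewrite !lne_EFin //. rewrite -(EFinM _ S) -!EFinB -EFinM -EFinD lee_fin.
have n0 : 0 < n.+1%:R :> R by rewrite ltr0n.
have S0 : 0 < S.
  rewrite /S big_ord_recl /= ltr_pwDl ?powR_gt0 //.
  by rewrite sumr_ge0 // => i _; rewrite powR_ge0.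
have := hN A0 An (n.+1%:R * S `^ t^-1)
  (sum_le_powR_sum t0 (fun k => cmod_ge0 _)).
move/le_trans; apply.
rewrite lnM ?posrE ?powR_gt0 // ln_powR.
have := ln_le_div_add S0 n0; set l := ln n.+1%:R; set s := ln S => hs.
set p := ln (cmod (A 0%N)); set q := ln (cmod (A n)).
have hs' : t^-1 * s <= t^-1 * (S / n.+1%:R + l) by rewrite ler_pM2l // invr_gt0.
rewrite -subr_ge0; set X := (X in 0 <= X).
have -> : X = K / delta * (2 * (t^-1 * (S / n.+1%:R + l) - t^-1 * s)).
  by rewrite /X; field; rewrite ?nat1r ?natr1 ?gt_eqF.
by rewrite mulr_ge0 ?(ltW Kd) // mulr_ge0 // subr_ge0.
Qed.

Context {d : measure_display} {T : measurableType d} (P : probability T R).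

(** The terms of the pointwise bound are integrable one by one, so its
    mean is the same combination of the moments. *)
Lemma expected_count_le n (A : nat -> T -> R[i]) (N : T -> R)
    (K delta t S L : R) :
  (0 < n)%N -> 0 < K -> 0 < delta -> 0 < t ->
  (forall k, (k <= n)%N -> complex_random_variable (A k)) ->
  (forall k, (k <= n)%N -> ('E_P[fun w => (cmod (A k w) `^ t)%R] <= S%:E)%E) ->
  (forall k, k = 0%N \/ k = n ->
    (- L%:E <= \int[P]_w lne (cmod (A k w))%:E)%E) ->
  (forall w, 0 <= N w) ->
  (forall w, A 0%N w != 0 -> A n w != 0 ->
    forall M, \sum_(k < n.+1) cmod (A k w) <= M ->
    N w <= K * (n%:R * delta +
      (2 * ln M + 2 - ln (cmod (A 0%N w)) - ln (cmod (A n w))) / delta)) ->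
  ('E_P[N] <= (K * (n%:R * delta + (2 + (2 + 2 / t) * ln n.+1%:R) / delta) +
      K / delta * (2 / t * S + L + L))%:E)%E.
Proof.
move=> n0 K0 d0 t0 mA hS hL N0 hN.
have n1 : 0 < n.+1%:R :> R by rewrite ltr0n.
rewrite unlock.
pose c := (K * (n%:R * delta + (2 + (2 + 2 / t) * ln n.+1%:R) / delta))%R.
pose a := (2 / (t * n.+1%:R))%R.
have a0 : 0 <= a by rewrite divr_ge0 // mulr_ge0 // ltW.
pose m k w := ((cmod (A k w) `^ t)%R%:E : \bar R).
pose l k w := lne (cmod (A k w))%:E.
have im k : (k <= n)%N -> P.-integrable setT (m k).
  move=> kn; apply: integrable_cmod_powR; first exact: mA.
  by apply: le_lt_trans (hS k kn) _; rewrite ltry.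
have il k : k = 0%N \/ k = n -> P.-integrable setT (l k).
  move=> hk; have kn : (k <= n)%N by case: hk => ->.
  apply: (integrable_lne_cmod (mA k kn) t0).
    by apply: le_lt_trans (hS k kn) _; rewrite ltry.
  by apply: lt_le_trans (hL k hk); rewrite -EFinN ltNyr.
pose s w := (\sum_(k < n.+1) m k w)%E.
have is0 : P.-integrable setT s.
  apply: (@integrable_sum _ _ _ _ _ measurableT) => k _.
  by apply: im; rewrite -ltnS.
pose h w := (a%:E * s w - l 0%N w - l n w)%E.
have ias : P.-integrable setT (fun w => (a%:E * s w)%E) by exact: integrableZl.
have i1 : P.-integrable setT (fun w => (a%:E * s w - l 0%N w)%E).
  by apply: (integrableB measurableT ias); apply: il; left.
have ih : P.-integrable setT h.
  by apply: (integrableB measurableT i1); apply: il; right.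
apply: le_trans (_ : \int[P]_w (c%:E + (K / delta)%:E * h w) <= _)%E.
  apply: integral_mono_nonneg => w; first by rewrite lee_fin.
  have := @zero_count_lne_le K delta t (N w) n (fun k => A k w)
    K0 d0 t0 (hN w).
  by rewrite /h /l /s /m sumEFin.
rewrite integralD //; last first.
- exact: integrableZl.
- exact: finite_measure_integrable_cst.
rewrite integral_cst // [X in (_ * X + _)%E](_ : _ = 1%E);
  last exact: probability_setT.
rewrite mule1 integralZl // EFinD.
apply: leeD2l; rewrite (EFinM (K / delta)); apply: lee_wpmul2l.
  by rewrite lee_fin divr_ge0 // ltW.
rewrite /h integralB //; last by apply: il; right.
rewrite integralB //; last by apply: il; left.
rewrite integralZl // (integral_sum measurableT); last first.
  by move=> k; apply: im; rewrite -ltnS.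
have -> : (2 / t * S = a * (\sum_(k < n.+1) S))%R.
  rewrite sumr_const card_ord -(mulr_natl S) /a; field.
  by rewrite ?nat1r ?natr1 ?gt_eqF.
rewrite !EFinD; apply: leeD; [apply: leeD|].
- rewrite (EFinM a); apply: lee_wpmul2l; first by rewrite lee_fin.
  rewrite -sumEFin; apply: lee_sum => k _; have := hS k; rewrite unlock; apply.
  by rewrite -ltnS.
- by rewrite leeNl; apply: hL; left.
- by rewrite leeNl; apply: hL; right.
Qed.
End Expectation.

Lemma ln_succ_le (R : realType) n :
  (2 <= n)%N -> ln n.+1%:R <= 2 * ln n%:R :> R.
Proof.
move=> n2; have nR : 0 < n%:R :> R by rewrite ltr0n; lia.
have -> : 2 * ln n%:R = ln (n%:R ^+ 2) :> R by rewrite lnXn // mulr_natl.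
rewrite ler_ln ?posrE ?exprn_gt0 // -natrX ler_nat; nia.
Qed.

Theorem proposition2p4 (R : realType) (d : measure_display)
  (T : measurableType d) (P : probability T R)
  (E : set R[i]) (hE : inscribed_polygon E)
  (A : nat -> nat -> T -> R[i])
  (hA : forall n k, (0 < n)%N -> (k <= n)%N ->
          complex_random_variable (A k n))
  (t : R) (ht : 0 < t)
  (hsup : (ereal_sup [set x : \bar R | exists n k,
             [/\ (0 < n)%N, (k <= n)%N
               & x = 'E_P[fun w => (cmod (A k n w) `^ t)%R]]] < +oo)%E)
  (hinf : (-oo < ereal_inf [set x : \bar R | exists n k,
             [/\ (0 < n)%N, (k = 0 \/ k = n)%N
               & x = \int[P]_w lne (cmod (A k n w))%:E]])%E) :
  exists C : R, \forall n \near \oo,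
    ('E_P[fun w => (n%:R * zero_counting n (random_poly A n w) E)%R]
       <= (C * Num.sqrt (n%:R * ln n%:R))%:E)%E.
Proof.
have [S S0 hS] := exists_real_upper_bound hsup.
set I := ereal_inf _ in hinf.
have [L L0 hL] : exists2 L : R, 0 <= L & (- L%:E <= I)%E.
  have [|L L0 hL] := @exists_real_upper_bound R (- I)%E; first by rewrite lteNl.
  by exists L => //; rewrite leeNl.
have [K [delta0 [K0 d00 hK]]] := polygon_zero_count hE.
have l2 : 0 < ln 2 :> R by rewrite ln_gt0 // ltr1n.
(* the factor 2 is from ln (n + 1) <= 2 ln n; bounded terms are absorbed by
   1 <= ln n / ln 2 *)
pose B := (2 + 2 / t) * 2 + (2 + (2 / t * S + L + L)) / ln 2.
exists (K * (1 + B)); near=> n.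
have n2 : (2 <= n)%N by near: n; exact: nbhs_infty_ge.
have n0 : (0 < n)%N by apply: leq_trans n2.
have nR : 0 < n%:R :> R by rewrite ltr0n.
have ln0 : ln 2 <= ln n%:R :> R by rewrite ler_ln ?posrE ?ler_nat.
have lnp : 0 < ln n%:R :> R := lt_le_trans l2 ln0.
pose delta : R := Num.sqrt (ln n%:R / n%:R).
have d0 : 0 < delta by rewrite sqrtr_gt0 divr_gt0.
have dd : delta <= delta0.
  by rewrite /delta; near: n; exact: near_sqrt_ln_div_le.
apply: le_trans (@expected_count_le R d T P n (fun k w => A k n w)
  (fun w => n%:R * zero_counting n (random_poly A n w) E)
  K delta t S L n0 K0 d0 ht _ _ _ _ _) _.
- by move=> k kn; exact: hA.
- move=> k kn; apply: le_trans hS; apply: ereal_sup_ubound.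
  by exists n, k.
- move=> k hk; apply: le_trans hL _; apply: ereal_inf_lbound.
  by exists n, k.
- move=> w; rewrite /zero_counting !mulr_ge0 ?invr_ge0 // sumr_ge0 // => z _.
- move=> w A0 An M AM; apply: hK => //; first by rewrite d0.
rewrite lee_fin -(mulrA K (1 + B)).
have l1 := ln_succ_le R n2.
have nd : n%:R * delta = Num.sqrt (n%:R * ln n%:R).
  rewrite -[X in X * delta](ger0_norm (ltW nR)) -sqrtr_sqr -sqrtrM ?sqr_ge0 //.
  by congr Num.sqrt; field; rewrite gt_eqF.
have ld : ln n%:R / delta = n%:R * delta.
  have dsq : delta ^+ 2 = ln n%:R / n%:R.
    by rewrite sqr_sqrtr // divr_ge0 // ltW.
  have -> : ln n%:R = delta ^+ 2 * n%:R by rewrite dsq divfK // gt_eqF.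
  by field; rewrite gt_eqF.
set Q := 2 / t * S + L + L.
have Q0 : 0 <= Q by rewrite !addr_ge0 // mulr_ge0 // divr_ge0 // ltW.
have hQ : 2 + Q <= (2 + Q) / ln 2 * ln n%:R.
  have h1 : 1 <= (ln 2)^-1 * ln n%:R :> R by rewrite mulrC ler_pdivlMr // mul1r.
  by rewrite -mulrA ler_peMr // addr_ge0.
rewrite -nd.
have -> : K * (n%:R * delta + (2 + (2 + 2 / t) * ln n.+1%:R) / delta) +
    K / delta * Q =
   K * (n%:R * delta + (2 + Q + (2 + 2 / t) * ln n.+1%:R) / delta).
  by field; rewrite !gt_eqF.
rewrite ler_pM2l // [leRHS]mulrDl mul1r lerD2l -ld mulrA ler_pM2r ?invr_gt0 //.
rewrite /B -/Q [leRHS]mulrDl [leRHS]addrC; apply: lerD => //.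
by rewrite -[leRHS]mulrA ler_wpM2l // addr_ge0 // divr_ge0 // ltW.
Unshelve. all: by end_near. Qed.
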